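(* Let $(\mathcal{E},\mathcal{G},\mathcal{F})$ be Riemann-suitable. Then for all $C\in\mathsf{pWhile}(\mathcal{E},\mathcal{G})$ and post-expectations $f\in\mathcal{F}\cap\mathbb{E}_{meas}$ and $g\in\mathcal{F}\cap\mathbb{E}^{\le1}_{meas}$ it holds that $$\sup_{n\ge1}\underline{\mathsf{wp}}^n[C^n](f)=\mathsf{wp}[C](f)\quad\text{and}\quad\mathsf{wlp}[C](g)=\inf_{n\ge1}\overline{\mathsf{wlp}}^n[C^n](g),$$ where $C^n$ is the $n$-fold loop unrolling of $C$.
   Context: Programs. Let $V$ be a finite set of program variables and $S=\mathbb{R}_{\ge 0}^V$ the set of states (functions $V\to\mathbb{R}_{\ge 0}$) with its Borel $\sigma$-algebra; $\sigma[x\mapsto\xi]$ is the state mapping $x$ to $\xi$ and agreeing with $\sigma$ elsewhere. Arithmetic expressions are measurable functions $E:S\to\mathbb{R}_{\ge 0}$; guards are measurable functions $\varphi:S\to\{\mathrm{true},\mathrm{false}\}$; $[\varphi]$ is the indicator function of $\varphi$. For a set $\mathcal{E}$ of arithmetic expressions and a set $\mathcal{G}$ of guards, $\mathsf{pWhile}(\mathcal{E},\mathcal{G})$ is generated by $C ::= \mathtt{skip} \mid \mathtt{diverge} \mid x:=E \mid \mathtt{observe}(\varphi) \mid x:\approx\mathtt{unif}_{[0,1]} \mid \mathtt{if}(\varphi)\{C\}\,\mathtt{else}\,\{C\} \mid \{C\}[p]\{C\} \mid C;C \mid \mathtt{while}(\varphi)\{C\}$, with $x\in V$, $E\in\mathcal{E}$,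 $\varphi\in\mathcal{G}$, $p\in[0,1]\cap\mathbb{Q}$. Unrolling. For $\ell\in\mathbb{N}$, $C^\ell$ is defined by: $C^\ell=C$ for atomic $C$ (the first five constructs); $(C_1;C_2)^\ell=C_1^\ell;C_2^\ell$; $(\mathtt{if}(\varphi)\{C_1\}\mathtt{else}\{C_2\})^\ell=\mathtt{if}(\varphi)\{C_1^\ell\}\mathtt{else}\{C_2^\ell\}$; $(\{C_1\}[p]\{C_2\})^\ell=\{C_1^\ell\}[p]\{C_2^\ell\}$; $(\mathtt{while}(\varphi)\{B\})^0=\mathtt{diverge}$; $(\mathtt{while}(\varphi)\{B\})^{\ell+1}=\mathtt{if}(\varphi)\{B^\ell;(\mathtt{while}(\varphi)\{B\})^\ell\}\mathtt{else}\{\mathtt{skip}\}$. Expectations. $\mathbb{E}$: all functions $S\to[0,\infty]$; $\mathbb{E}^{\le 1}$: all functions $S\to[0,1]$; $\mathbb{E}_{meas}$, $\mathbb{E}^{\le 1}_{meas}$: the Borel measurable ones. Order, suprema, infima, $+$ and $\cdot$ are pointwise ($0\cdot\infty=0$). $f[x/E]=\big(\sigma\mapsto f(\sigma[x\mapsto E(\sigma)])\big)$. Transformers. $\mathsf{wp}[C]:\mathbb{E}_{meas}\to\mathbb{E}_{meas}$: $\mathsf{wp}[\mathtt{skip}](f)=f$; $\mathsf{wp}[\mathtt{diverge}](f)=0$; $\mathsf{wp}[x:=E](f)=f[x/E]$; $\mathsf{wp}[x:\approx\mathtt{unif}_{[0,1]}](f)(\sigma)=\int_{[0,1]}f(\sigma[x\mapsto\xi])\,d\lambda(\xi)$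 (Lebesgue integral); $\mathsf{wp}[\mathtt{observe}(\varphi)](f)=[\varphi]\cdot f$; $\mathsf{wp}[\mathtt{if}(\varphi)\{C_1\}\mathtt{else}\{C_2\}](f)=[\varphi]\cdot\mathsf{wp}[C_1](f)+[\neg\varphi]\cdot\mathsf{wp}[C_2](f)$; $\mathsf{wp}[\{C_1\}[p]\{C_2\}](f)=p\cdot\mathsf{wp}[C_1](f)+(1-p)\cdot\mathsf{wp}[C_2](f)$; $\mathsf{wp}[C_1;C_2](f)=\mathsf{wp}[C_1](\mathsf{wp}[C_2](f))$; $\mathsf{wp}[\mathtt{while}(\varphi)\{B\}](f)$ is the least fixed point of $Y\mapsto[\neg\varphi]\cdot f+[\varphi]\cdot\mathsf{wp}[B](Y)$. $\mathsf{wlp}[C]:\mathbb{E}^{\le 1}_{meas}\to\mathbb{E}^{\le 1}_{meas}$: same rules except $\mathsf{wlp}[\mathtt{diverge}](f)=1$ and greatest instead of least fixed points for loops. For an integer $N\ge1$, $\underline{\mathsf{wp}}^N[C]:\mathbb{E}\to\mathbb{E}$ follows the rules of $\mathsf{wp}$ (on all of $\mathbb{E}$) except $\underline{\mathsf{wp}}^N[x:\approx\mathtt{unif}_{[0,1]}](f)=\frac1N\sum_{i=0}^{N-1}\inf_{\xi\in[i/N,(i+1)/N]}f[x/\xi]$; $\overline{\mathsf{wlp}}^N[C]:\mathbb{E}^{\le1}\to\mathbb{E}^{\le1}$ follows the rules of $\mathsf{wlp}$ (on all of $\mathbb{E}^{\le1}$) except $\overline{\mathsf{wlp}}^N[x:\approx\mathtt{unif}_{[0,1]}](f)=\frac1N\sum_{i=0}^{N-1}\sup_{\xi\in[i/N,(i+1)/N]}f[x/\xi]$.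 Riemann-suitability. A function $h$ on $S$ with values in $\mathbb{R}\cup\{\pm\infty\}$ is locally bounded if $\sup_{\sigma\in K}|h(\sigma)|<\infty$ for all compact $K\subseteq S$. $f$ is Riemann-integrable on $[0,1]$ w.r.t. $x\in V$ if for all $\sigma\in S$ the function $[0,1]\to\mathbb{R},\ \xi\mapsto f(\sigma[x\mapsto\xi])$ is Riemann-integrable. A triple $(\mathcal{E},\mathcal{G},\mathcal{F})$ of a class $\mathcal{E}$ of locally bounded arithmetic expressions, a class $\mathcal{G}$ of guards and a class $\mathcal{F}\subseteq\mathbb{E}$ of locally bounded expectations is Riemann-suitable if every $f\in\mathcal{F}$ is Riemann-integrable on $[0,1]$ w.r.t. every $x\in V$, $\mathcal{F}$ contains the constants $0,1$, and: (i) for all $f\in\mathcal{F}$, $x\in V$, $[a,b]\subseteq[0,1]$: $\inf_{\xi\in[a,b]}f[x/\xi]\in\mathcal{F}$ and $\sup_{\xi\in[a,b]}f[x/\xi]\in\mathcal{F}$; (ii) for all $f\in\mathcal{F}$, $E\in\mathcal{E}$, $x\in V$: $f[x/E]\in\mathcal{F}$; (iii) for all $f,g\in\mathcal{F}$, $p\in[0,1]\cap\mathbb{Q}$: $p\cdot f+(1-p)\cdot g\in\mathcal{F}$; (iv) for all $f,g\in\mathcal{F}$, $\varphi\in\mathcal{G}$: $[\varphi]\cdot f+[\neg\varphi]\cdot g\in\mathcal{F}$. *)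

(* Defs.v *)
From HB Require Import structures.
From mathcomp Require Import all_boot all_order all_algebra.
From mathcomp Require Import all_classical all_reals all_analysis.
From mathcomp Require Import measurable_realfun.

Set Implicit Arguments.
Unset Strict Implicit.
Unset Printing Implicit Defensive.

Import Order.TTheory GRing.Theory Num.Theory.
Import numFieldNormedType.Exports.

Local Open Scope classical_set_scope.
Local Open Scope ring_scope.

Definition state (R : realType) (V : finType) : Type := V -> {nonneg R}.

Section StateStructures.
Variables (R : realType) (V : finType).

Definition state_val (s : state R V) : {ptws V -> R} := fun x => (s x)%:num.

HB.instance Definition _ := Choice.on (state R V).
HB.instance Definition _ := isPointed.Build (state R V) (fun _ => 0%:nng).

(* The subspace topology of R^V and its Borel sigma-algebra. *)
HB.instance Definition _ :=
  Topological.copy (state R V) (initial_topology state_val).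
HB.instance Definition _ :=
  Measurable.copy (state R V) (g_sigma_algebraType (@open (state R V))).

End StateStructures.

Definition upd (R : realType) (V : finType)
    (s : state R V) (x : V) (a : {nonneg R}) : state R V :=
  fun y => if y == x then a else s y.

Lemma max0_ge0 (R : realType) (xi : R) : 0 <= Num.max 0 xi.
Proof. by rewrite le_max lexx. Qed.

(* max(0, xi); below it is only applied to xi in [0, 1], so that
   updr s x xi is the state s[x |-> xi]. *)
Definition nnpart (R : realType) (xi : R) : {nonneg R} := NngNum (max0_ge0 xi).

Definition updr (R : realType) (V : finType)
    (s : state R V) (x : V) (xi : R) : state R V := upd s x (nnpart xi).

Record aexp (R : realType) (V : finType) := AExp {
  aexp_fun :> state R V -> {nonneg R};
  aexp_measurable : measurable_fun setT (fun s => (aexp_fun s)%:num) }.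

Definition guard (R : realType) (V : finType) := {mfun state R V >-> bool}.

Inductive pWhile (R : realType) (V : finType)
    (E : set (aexp R V)) (G : set (guard R V)) : Type :=
| Skip
| Diverge
| Assign (x : V) (e : aexp R V) of E e
| Observe (phi : guard R V) of G phi
| Unif (x : V)
| If (phi : guard R V) of G phi & pWhile E G & pWhile E G
| PChoice (p : {i01 rat}) of pWhile E G & pWhile E G
| Seq of pWhile E G & pWhile E G
| While (phi : guard R V) of G phi & pWhile E G.

Arguments Skip {R V E G}.
Arguments Diverge {R V E G}.
Arguments Unif {R V E G} x.

Fixpoint unroll (R : realType) (V : finType)
    (E : set (aexp R V)) (G : set (guard R V))
    (C : pWhile E G) : nat -> pWhile E G :=
  match C with
  | If _ hphi C1 C2 => fun l => If hphi (unroll C1 l) (unroll C2 l)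
  | PChoice p C1 C2 => fun l => PChoice p (unroll C1 l) (unroll C2 l)
  | Seq C1 C2 => fun l => Seq (unroll C1 l) (unroll C2 l)
  | While _ hphi B =>
      fix unroll_while (l : nat) : pWhile E G :=
        if l is l'.+1 then If hphi (Seq (unroll B l') (unroll_while l')) Skip
        else Diverge
  | _ => fun _ => C
  end.

Section Expectations.
Variables (R : realType) (V : finType).
Local Open Scope ereal_scope.

Definition expectationT := state R V -> \bar R.

Definition Exp : set expectationT := [set f | forall s, 0 <= f s].
Definition Exp1 : set expectationT := [set f | forall s, 0 <= f s <= 1].
Definition meas : set expectationT :=
  [set f : state R V -> \bar R | measurable_fun setT f].
Definition Exp_meas : set expectationT := Exp `&` meas.
Definition Exp1_meas : set expectationT := Exp1 `&` meas.

Definition iverson (b : bool) : \bar R := (b%:R)%:E.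

(* The least and the greatest fixed point of Phi in D for the pointwise order;
   the first argument of xget is the value when there is none. *)
Definition lfp (D : set expectationT) (Phi : expectationT -> expectationT) :
    expectationT :=
  xget (cst 0) [set Y | [/\ D Y, Phi Y = Y &
    forall Z, D Z -> Phi Z = Z -> forall s, Y s <= Z s]].

Definition gfp (D : set expectationT) (Phi : expectationT -> expectationT) :
    expectationT :=
  xget (cst 1) [set Y | [/\ D Y, Phi Y = Y &
    forall Z, D Z -> Phi Z = Z -> forall s, Z s <= Y s]].

(* The rules common to the four transformers. The parameters are the value of
   diverge, the rule for uniform sampling and the choice of fixed points. *)
Fixpoint transformer (E : set (aexp R V)) (G : set (guard R V))
    (dvg : \bar R) (unif : V -> expectationT -> expectationT)
    (fixp : (expectationT -> expectationT) -> expectationT)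
    (C : pWhile E G) : expectationT -> expectationT :=
  let T := @transformer E G dvg unif fixp in
  match C with
  | Skip => fun f => f
  | Diverge => fun _ => cst dvg
  | Assign x e _ => fun f s => f (upd s x (e s))
  | Observe phi _ => fun f s => iverson (phi s) * f s
  | Unif x => unif x
  | If phi _ C1 C2 => fun f s =>
      iverson (phi s) * T C1 f s + iverson (~~ phi s) * T C2 f s
  | PChoice p C1 C2 => fun f s =>
      (ratr p%:num)%:E * T C1 f s + (1 - ratr p%:num)%R%:E * T C2 f s
  | Seq C1 C2 => fun f => T C1 (T C2 f)
  | While phi _ B => fun f => fixp (fun Y s =>
      iverson (~~ phi s) * f s + iverson (phi s) * T B Y s)
  end.

Definition unif_int (x : V) (f : expectationT) : expectationT :=
  fun s => \int[lebesgue_measure]_(xi in `[0%R, 1%R]) f (updr s x xi).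

Definition inf_on (a b : R) (x : V) (f : expectationT) : expectationT :=
  fun s => ereal_inf [set f (updr s x xi) | xi in `[a, b]].

Definition sup_on (a b : R) (x : V) (f : expectationT) : expectationT :=
  fun s => ereal_sup [set f (updr s x xi) | xi in `[a, b]].

Definition unif_lower (N : nat) (x : V) (f : expectationT) : expectationT :=
  fun s => (N%:R^-1)%R%:E *
    \sum_(0 <= i < N) inf_on (i%:R / N%:R)%R (i.+1%:R / N%:R)%R x f s.

Definition unif_upper (N : nat) (x : V) (f : expectationT) : expectationT :=
  fun s => (N%:R^-1)%R%:E *
    \sum_(0 <= i < N) sup_on (i%:R / N%:R)%R (i.+1%:R / N%:R)%R x f s.

Section Transformers.
Variables (E : set (aexp R V)) (G : set (guard R V)).

Definition wp : pWhile E G -> expectationT -> expectationT :=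
  transformer 0 unif_int (lfp Exp_meas).

Definition wlp : pWhile E G -> expectationT -> expectationT :=
  transformer 1 unif_int (gfp Exp1_meas).

Definition lower_wp (N : nat) : pWhile E G -> expectationT -> expectationT :=
  transformer 0 (unif_lower N) (lfp Exp).

Definition upper_wlp (N : nat) : pWhile E G -> expectationT -> expectationT :=
  transformer 1 (unif_upper N) (gfp Exp1).

End Transformers.

Definition locally_bounded (h : expectationT) : Prop :=
  forall K : set (state R V), compact K ->
    ereal_sup [set `|h s| | s in K] < +oo.

End Expectations.

(* Convergence of the Riemann sums over the tagged partitions
   a = x_0 < x_1 < ... < x_n = b, with tags t_i in [x_i, x_(i+1)], as the mesh
   goes to 0. *)
Definition riemann_integrable (R : realType) (a b : R) (h : R -> R) : Prop :=
  exists I : R, forall eps : R, 0 < eps -> exists2 delta : R, 0 < delta &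
  forall (xs : seq R) (t : nat -> R), itv_partition a b xs ->
    let x := nth b (a :: xs) in
    (forall i, (i < size xs)%N -> x i <= t i <= x i.+1 /\ x i.+1 - x i < delta) ->
    `|\sum_(0 <= i < size xs) h (t i) * (x i.+1 - x i) - I| < eps.

Section RiemannSuitable.
Variables (R : realType) (V : finType).

Definition riemann_integrable_wrt (f : expectationT R V) (x : V) : Prop :=
  forall s : state R V,
    (forall xi : R, 0 <= xi <= 1 -> f (updr s x xi) \is a fin_num) /\
    riemann_integrable 0 1 (fun xi => fine (f (updr s x xi))).

Record riemann_suitable (E : set (aexp R V)) (G : set (guard R V))
    (F : set (expectationT R V)) : Prop := RiemannSuitable {
  suitable_E_bounded : forall e, E e -> locally_bounded (fun s => (e s)%:num%:E);
  suitable_F_exp : F `<=` @Exp R V;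
  suitable_F_bounded : forall f, F f -> locally_bounded f;
  suitable_F_integrable : forall f x, F f -> riemann_integrable_wrt f x;
  suitable_0 : F (cst 0%E);
  suitable_1 : F (cst 1%E);
  suitable_inf : forall f x (a b : R), F f -> 0 <= a -> a <= b -> b <= 1 ->
    F (inf_on a b x f);
  suitable_sup : forall f x (a b : R), F f -> 0 <= a -> a <= b -> b <= 1 ->
    F (sup_on a b x f);
  suitable_subst : forall f (e : aexp R V) x, F f -> E e ->
    F (fun s => f (upd s x (e s)));
  suitable_mix : forall f g (p : {i01 rat}), F f -> F g ->
    F (fun s => (ratr p%:num)%:E * f s + (1 - ratr p%:num)%R%:E * g s)%E;
  suitable_if : forall f g (phi : guard R V), F f -> F g -> G phi ->
    F (fun s => iverson R (phi s) * f s + iverson R (~~ phi s) * g s)%E }.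

End RiemannSuitable.

(* Main.v *)
(** A Riemann-integrable function lies between step functions of its cells whose
    oscillations have integrals tending to [0]. Hence, if [k = sup_n h_n] is Borel
    for an increasing sequence of functions that are Riemann-integrable in the
    sampled variable, the integral of [k] is the supremum of the lower sums of
    [h_n] over [2^n] cells, even though the [h_n] need not be Borel measurable.
    By induction on [C], the transformer of [C] maps [sup_n h_n] to the supremum
    of the approximations of order [n] of [C] at [h_n]; the resulting sequence
    stays in [F], and it is increasing because dyadic partitions refine each
    other. For a loop the induction hypothesis is applied along the Kleene
    iterates, which exhaust the least fixed point by continuity. The statement on
    wlp is the same one for the complement [1 - g]: the class of the [1 - f] with
    [f] in [F] bounded by [1] is again suitable, and a greatest fixed point
    becomes a least one, provided that a failed observation returns [1]. *)

Require Import Defs.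
From mathcomp Require Import all_boot all_order all_algebra.
From mathcomp Require Import all_classical all_reals all_analysis.
From mathcomp Require Import measurable_realfun lra ring.

Set Implicit Arguments.
Unset Strict Implicit.
Unset Printing Implicit Defensive.

Import Order.TTheory GRing.Theory Num.Theory.
Import numFieldNormedType.Exports.

Local Open Scope classical_set_scope.
Local Open Scope ring_scope.

(** * Measurability of maps into the state space *)

Section StateMeasurability.
Variables (R : realType) (V : finType).

(** The filter generated by the uniform balls around [s] converges in every coordinate, hence in the
    product topology, so it contains each open set around [s]. *)
Lemma state_open_ball (U : set (state R V)) (s : state R V) :
  open U -> U s -> exists2 e : R, 0 < e &
    [set t : state R V | forall y, `|(s y)%:num - (t y)%:num| < e] `<=` U.
Proof.
case=> W oW <- Ws.
pose b (e : R) := [set h : {ptws V -> R} | forall y, `|state_val s y - h y| < e].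
pose FF := filter_from [set e : R | 0 < e] b.
have FFF : Filter FF.
  apply: filter_from_filter; first by exists 1 => /=.
  move=> i j /= i0 j0; exists (Num.min i j); first by rewrite /= lt_min i0.
  by move=> h bh; split=> y; apply: lt_le_trans (bh y) _; rewrite ge_min lexx ?orbT.
have cvgF : FF --> (state_val s : {ptws V -> R}).
  apply/cvg_sup => y A [_ [[B oB <-] /= Bsy] sBA].
  have : nbhs (state_val s y) B by exact: open_nbhs_nbhs.
  move=> /nbhs_ballP[e /= e0 sB]; exists e => // h bh.
  by apply: sBA; apply: sB; exact: bh.
have [e /= e0 be] : FF W by apply: cvgF; exact: open_nbhs_nbhs.
by exists e => // t bt; exact: be.
Qed.

Lemma coordinate_open (y : V) (A : set R) :
  open A -> open [set s : state R V | A (s y)%:num].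
Proof.
move=> oA; exists [set h : {ptws V -> R} | A (h y)] => //.
exact: open_comp (fun (h : {ptws V -> R}) _ => @proj_continuous V (fun=> R) y h) oA.
Qed.

Lemma measurable_coordinate (y : V) :
  measurable_fun setT (fun s : state R V => (s y)%:num).
Proof.
apply: (measurability _ (RGenOpens.measurableE R)).
by move=> _ [_ [a [b ->] <-]]; rewrite setTI; apply: sub_sigma_algebra;
  exact: (@coordinate_open y `]a, b[%classic).
Qed.

(* The rational boxes form a countable base, so that the Borel sigma-algebra of
   the state space is generated by the coordinates. *)
Lemma measurable_fun_state d (T : measurableType d) (phi : T -> state R V) :
  (forall y, measurable_fun setT (fun t => (phi t y)%:num)) ->
  measurable_fun setT phi.
Proof.
move=> mphi; apply: (@measurability _ _ _ _ _ _ (@open (state R V))) => //.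
move=> _ [U oU <-]; rewrite setTI.
(* Indexing the boxes by finite functions into [rat * rat] makes the index type countable. *)
pose box (q : {ffun V -> rat * rat}) := [set s : state R V |
  forall y, ratr (q y).1 < (s y)%:num < ratr (q y).2].
have -> : phi @^-1` U = \bigcup_(q in [set q | box q `<=` U]) (phi @^-1` box q).
  apply/seteqP; split=> [t Ut|t [q /= qU]]; last exact: qU.
  have [e e0 eU] := state_open_ball oU Ut.
  have /choice[q qP] (y : V) : exists q : rat * rat,
      ((phi t y)%:num - e / 2 < ratr q.1 < (phi t y)%:num) /\
      ((phi t y)%:num < ratr q.2 < (phi t y)%:num + e / 2).
    have e2 : 0 < e / 2 by rewrite divr_gt0.
    have [|a] := @rat_in_itvoo R ((phi t y)%:num - e / 2) (phi t y)%:num.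
      by rewrite ltrBlDr ltrDl.
    rewrite in_itv /= => ha.
    have [|c] := @rat_in_itvoo R (phi t y)%:num ((phi t y)%:num + e / 2).
      by rewrite ltrDl.
    by rewrite in_itv /= => hc; exists (a, c).
  exists [ffun y => q y] => /=; last first.
    by move=> y; rewrite ffunE; have [/andP[_ ->] /andP[->]] := qP y.
  move=> s bs; apply: eU => y; have := bs y; rewrite ffunE.
  have [/andP[q1 q2] /andP[q3 q4] /andP[q5 q6]] := qP y.
  by rewrite ltr_distl; apply/andP; split; lra.
rewrite bigcup_mkcond; apply: countable_bigcupT_measurable => // q.
case: ifP => // _.
rewrite (_ : _ @^-1` _ = \bigcap_(y in [set: V])
    ((fun t => (phi t y)%:num) @^-1` `]ratr (q y).1, ratr (q y).2[)); last first.
  apply/seteqP; split=> t /= h y; first by move=> _; rewrite /= in_itv /= h.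
  by have := h y I; rewrite /= in_itv.
apply: fin_bigcap_measurable => // y _.
by rewrite -[X in measurable X]setTI; exact: mphi.
Qed.

Lemma measurable_upd (x : V) (e : aexp R V) :
  measurable_fun setT (fun s : state R V => upd s x (e s)).
Proof.
apply: measurable_fun_state => y; rewrite /upd; case: eqP => _.
  exact: aexp_measurable.
exact: measurable_coordinate.
Qed.

Lemma measurable_updr (x : V) :
  measurable_fun setT (fun p : state R V * R => updr p.1 x p.2).
Proof.
apply: measurable_fun_state => y; rewrite /updr /upd; case: eqP => _ /=.
  apply: measurable_maxr; first exact: measurable_cst.
  exact: measurable_snd.
exact: (measurableT_comp (measurable_coordinate y) measurable_fst).
Qed.

Lemma measurable_updr_slice (s : state R V) (x : V) :
  measurable_fun setT (fun xi : R => updr s x xi).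
Proof.
apply: measurable_fun_state => y; rewrite /updr /upd; case: eqP => _ /=.
  by apply: measurable_maxr => //; exact: measurable_cst.
exact: measurable_cst.
Qed.

End StateMeasurability.

(** * Step functions and Riemann integrability *)

Section StepFunctions.
Variable R : realType.
Implicit Types (N i j q : nat) (c : nat -> \bar R) (h : R -> \bar R) (xi : R).

(** Closed cells carry the infima of the lower sums. Half-open cells partition [[0, 1[], so that a
    step function takes a single coefficient at each point. *)
Definition cell N i : interval R := `[i%:R / N%:R, i.+1%:R / N%:R].
Definition hcell N i : interval R := `[i%:R / N%:R, i.+1%:R / N%:R[.

Definition step N c xi : \bar R :=
  (\sum_(0 <= i < N) c i * (\1_[set` hcell N i] xi)%:E)%E.

Definition cell_inf h N i : \bar R := ereal_inf [set h xi | xi in [set` cell N i]].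

(** The oscillation is a supremum over pairs of points, so that a sum of oscillations is controlled
    by pairs of tag families. *)
Definition osc (u : R -> R) N i : \bar R :=
  ereal_sup [set (u p.1 - u p.2)%:E | p in [set` cell N i] `*` [set` cell N i]].

Lemma hcell_cell N i xi : xi \in hcell N i -> xi \in cell N i.
Proof. by rewrite !in_itv /= => /andP[-> /ltW]. Qed.

Lemma cell_sub01 N i xi : (i < N)%N -> xi \in cell N i -> 0 <= xi <= 1.
Proof.
move=> iN; rewrite in_itv /= => /andP[a b].
have N0 : 0 < N%:R :> R by rewrite ltr0n (leq_ltn_trans _ iN).
rewrite (le_trans _ a) ?divr_ge0//= (le_trans b)//.
by rewrite ler_pdivrMr// mul1r ler_nat.
Qed.

Lemma hcell_sub01 N i xi : (i < N)%N -> xi \in hcell N i -> 0 <= xi < 1.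
Proof.
move=> iN; rewrite in_itv /= => /andP[a b].
have N0 : 0 < N%:R :> R by rewrite ltr0n (leq_ltn_trans _ iN).
rewrite (le_trans _ a) ?divr_ge0//= (lt_le_trans b)//.
by rewrite ler_pdivrMr// mul1r ler_nat.
Qed.

(** From [j %/ q * q <= j < (j %/ q).+1 * q]: the coarse cell around the fine cell [j] has index
    [j %/ q]. *)
Lemma cell_refine_bounds N q j : (0 < N)%N -> (0 < q)%N ->
  (j %/ q)%:R / N%:R <= j%:R / (N * q)%:R :> R /\
  j.+1%:R / (N * q)%:R <= (j %/ q).+1%:R / N%:R :> R.
Proof.
move=> N0 q0.
have N0' : 0 < N%:R :> R by rewrite ltr0n.
have q0' : 0 < q%:R :> R by rewrite ltr0n.
rewrite natrM invfM !mulrA ![_ / N%:R / q%:R]mulrAC !ler_pM2r ?invr_gt0//.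
rewrite ler_pdivlMr// ler_pdivrMr// -!natrM !ler_nat.
by split; [exact: leq_divM | exact: ltn_ceil].
Qed.

Lemma cell_refine N q j xi : (0 < N)%N -> (0 < q)%N ->
  xi \in cell (N * q) j -> xi \in cell N (j %/ q).
Proof.
move=> N0 q0; rewrite !in_itv /= => /andP[a b].
have [a' b'] := @cell_refine_bounds N q j N0 q0.
by rewrite (le_trans a' a) (le_trans b b').
Qed.

Lemma hcell_refine N q j xi : (0 < N)%N -> (0 < q)%N ->
  xi \in hcell (N * q) j -> xi \in hcell N (j %/ q).
Proof.
move=> N0 q0; rewrite !in_itv /= => /andP[a b].
have [a' b'] := @cell_refine_bounds N q j N0 q0.
by rewrite (le_trans a' a) (lt_le_trans b b').
Qed.

Lemma hcell_uniq N i j xi : (0 < N)%N ->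
  xi \in hcell N i -> xi \in hcell N j -> i = j.
Proof.
move=> N0; rewrite !in_itv /= => /andP[a b] /andP[a' b'].
have N0' : 0 < N%:R^-1 :> R by rewrite invr_gt0 ltr0n.
have := le_lt_trans a b'; have := le_lt_trans a' b.
rewrite !ltr_pM2r// !ltr_nat !ltnS => h1 h2.
by apply/eqP; rewrite eqn_leq h1 h2.
Qed.

Lemma hcell_cover N xi : (0 < N)%N -> 0 <= xi < 1 ->
  exists2 j, (j < N)%N & xi \in hcell N j.
Proof.
move=> N0 /andP[x0 x1]; have N0' : 0 < N%:R :> R by rewrite ltr0n.
have xN0 : 0 <= xi * N%:R by rewrite mulr_ge0.
have /andP[t1 t2] := truncn_itv xN0.
exists (Num.truncn (xi * N%:R)).
  rewrite -(ltr_nat R) (le_lt_trans t1)//.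
  by rewrite -[ltRHS]mul1r ltr_pM2r.
by rewrite in_itv /= ler_pdivrMr// t1 ltr_pdivlMr.
Qed.

Lemma step_hcell N c j xi : (j < N)%N -> xi \in hcell N j -> step N c xi = c j.
Proof.
move=> jN xj; rewrite /step (bigD1_seq j) ?mem_index_iota ?iota_uniq//=.
rewrite indicE mem_set// mule1 big1_seq ?adde0// => i /andP[ij _].
rewrite indicE memNset ?mule0// => xi_i.
move: ij; rewrite (hcell_uniq _ xi_i xj) ?eqxx//.
exact: leq_ltn_trans jN.
Qed.

Lemma step_ge0 N c xi : (forall i, (i < N)%N -> (0 <= c i)%E) -> (0 <= step N c xi)%E.
Proof.
move=> c0; rewrite /step big_nat_cond sume_ge0// => i /andP[/= iN _].
by rewrite mule_ge0// ?c0// lee_fin indicE.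
Qed.

Lemma measurable_step D N c : measurable_fun D (step N c).
Proof.
apply: emeasurable_sum => i; apply: measurable_funeM.
apply/measurable_EFinP; apply: measurable_funTS; exact: measurable_indic.
Qed.

Lemma integral_step N c : (0 < N)%N -> (forall i, (i < N)%N -> (0 <= c i)%E) ->
  (\int[lebesgue_measure]_(xi in `[0%R, 1%R[) step N c xi
   = (N%:R^-1)%:E * \sum_(0 <= i < N) c i)%E.
Proof.
move=> N0 c0; have N0' : 0 < N%:R :> R by rewrite ltr0n.
(* Extending the coefficients by [0] makes them nonnegative at every index, as the exchange of sum
   and integral demands. *)
pose c' i := if (i < N)%N then c i else 0%E.
have c'0 i : (0 <= c' i)%E by rewrite /c'; case: ifPn => // /c0.
have -> : step N c = step N c'.
  by apply/funext => xi; apply: eq_big_nat => i /= iN; rewrite /c' iN.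
have -> : (\sum_(0 <= i < N) c i = \sum_(0 <= i < N) c' i)%E.
  by apply: eq_big_nat => i /= iN; rewrite /c' iN.
rewrite /step ge0_integral_sum//=; last 2 first.
- move=> i; apply: measurable_funeM; apply/measurable_EFinP.
  by apply: measurable_funTS; exact: measurable_indic.
- by move=> i x _; rewrite mule_ge0// lee_fin indicE.
rewrite ge0_sume_distrr//; apply: eq_big_nat => i /= iN.
rewrite ge0_integralZl//=; last first.
  by apply/measurable_EFinP; apply: measurable_funTS; exact: measurable_indic.
rewrite integral_indic//= (_ : _ `&` _ = [set` hcell N i]); last first.
  by apply/setIidl => x /= /(hcell_sub01 iN); rewrite in_itv.
rewrite /hcell lebesgue_measure_itv /= lte_fin ltr_pM2r ?invr_gt0// ltr_nat ltnSn.
by rewrite muleC -EFinB -mulrBl -natrB// subSnn mul1r /c' iN.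
Qed.

Lemma cell_inf_ge0 h N i : (i < N)%N ->
  (forall xi, 0 <= xi <= 1 -> (0 <= h xi)%E) -> (0 <= cell_inf h N i)%E.
Proof.
move=> iN h0; apply: le_ereal_inf_tmp => _ [xi /= /(cell_sub01 iN) xi01 <-].
exact: h0.
Qed.

Lemma cell_inf_le h N i xi : xi \in cell N i -> (cell_inf h N i <= h xi)%E.
Proof. by move=> xi_i; apply: ereal_inf_lbound; exists xi. Qed.

Lemma cell_mem N i : (i < N)%N -> i%:R / N%:R \in cell N i.
Proof.
move=> iN; have N0 : 0 < N%:R :> R by rewrite ltr0n (leq_ltn_trans _ iN).
by rewrite in_itv /= lexx /= ler_pM2r ?invr_gt0// ler_nat.
Qed.

Lemma osc_ge0 (u : R -> R) N i : (i < N)%N -> (0 <= osc u N i)%E.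
Proof.
move=> iN; apply: ereal_sup_ubound.
exists (i%:R / N%:R, i%:R / N%:R) => /=; last by rewrite subrr.
by split; exact: cell_mem.
Qed.

Lemma step_cell_inf_refine h N q xi : (0 < N)%N -> (0 < q)%N -> 0 <= xi < 1 ->
  (step N (cell_inf h N) xi <= step (N * q) (cell_inf h (N * q)) xi)%E.
Proof.
move=> N0 q0 xi01.
have [|j jN xij] := @hcell_cover (N * q) xi _ xi01; first by rewrite muln_gt0 N0.
rewrite (step_hcell _ jN xij).
rewrite (@step_hcell N _ (j %/ q)) ?ltn_divLR ?(hcell_refine _ _ xij)//.
apply: le_ereal_inf_tmp => _ [z /= zj <-]; apply: cell_inf_le.
exact: cell_refine zj.
Qed.

End StepFunctions.

(** * Oscillation sums of Riemann-integrable functions *)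

Section Darboux.
Variable R : realType.

(** The points [t i] are chosen independently: with the last one fixed at [a], the other suprema sum
    to at most [c - u a] by induction, and then the supremum over [a] is taken. *)
Lemma sum_ereal_sup_le (T : pointedType) (A : nat -> set T) (u : T -> R) N (c : R) :
  (forall i, (i < N)%N -> A i !=set0) ->
  (forall t : nat -> T, (forall i, (i < N)%N -> A i (t i)) ->
    \sum_(0 <= i < N) u (t i) <= c) ->
  (\sum_(0 <= i < N) ereal_sup [set (u a)%:E | a in A i] <= c%:E)%E.
Proof.
elim: N c => [|N ih] c A0 le_c.
  rewrite big_nil lee_fin.
  by have := le_c (fun=> point); rewrite big_nil; apply.
rewrite big_nat_recr//=; set S := (\sum_(0 <= i < N) _)%E.
have S_le a : A N a -> (S <= (c - u a)%:E)%E.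
  move=> Aa; apply: ih => [i iN|t At]; first by apply: A0; exact: ltnW.
  rewrite lerBrDr.
  have := le_c (fun i => if i == N then a else t i).
  rewrite big_nat_recr//= eqxx.
  rewrite (_ : \sum_(0 <= i < N) _ = \sum_(0 <= i < N) u (t i)); last first.
    by apply: eq_big_nat => i /= iN; rewrite ltn_eqF.
  by apply=> i; rewrite ltnS leq_eqVlt; case: eqP => [->//|_] /= iN; exact: At.
have [a0 Aa0] := A0 N (ltnSn N).
have := S_le _ Aa0; case: S S_le => [r|//|] S_le _; last by rewrite addNye leNye.
rewrite -leeBrDl//; apply: ge_ereal_sup => _ [a Aa <-].
by rewrite -EFinB lee_fin; have := S_le a Aa; rewrite lee_fin lerBrDl addrC -lerBrDl.
Qed.

(** Any two tag families of a fine uniform partition have Riemann sums within [eps / 2] of [I], so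
    their sums differ by less than [eps]; the supremum over pairs of tags gives the oscillations. *)
Lemma riemann_integrable_osc (u : R -> R) :
  riemann_integrable 0 1 u -> forall eps : R, 0 < eps ->
  exists M, forall N, (M < N)%N ->
    (N%:R^-1%:E * \sum_(0 <= i < N) osc u N i <= eps%:E)%E.
Proof.
move=> [I HI] eps eps0.
have [|d d0 Hd] := HI (eps / 2); first by rewrite divr_gt0.
(* Every [N] beyond this bound has mesh [1 / N < d]. *)
exists (Num.truncn d^-1) => N dN.
have N0 : 0 < N%:R :> R by rewrite ltr0n (leq_ltn_trans _ dN).
have Nd : N%:R^-1 < d.
  rewrite -[ltRHS]invrK ltf_pV2 ?posrE ?invr_gt0//.
  rewrite (lt_le_trans (truncnS_gt _))// ler_nat//.
rewrite lee_pdivrMl//.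
rewrite -EFinM; apply: sum_ereal_sup_le => [i iN|t At].
  by exists (i%:R / N%:R, i%:R / N%:R); split; exact: cell_mem.
pose xs : seq R := mkseq (fun i => i.+1%:R / N%:R) N.
have nth_xs i : (i <= N)%N -> nth 1 (0 :: xs) i = i%:R / N%:R.
  case: i => [|i] iN /=; first by rewrite mul0r.
  by rewrite nth_mkseq.
have xsP : itv_partition 0 1 xs.
  split.
    apply/(pathP 1) => i; rewrite size_mkseq => iN.
    rewrite nth_xs; last exact: ltnW.
    by rewrite nth_mkseq// ltr_pM2r ?invr_gt0// ltr_nat.
  rewrite (last_nth 1) size_mkseq nth_xs// divff// lt0r_neq0//.
have close v : (forall i, (i < N)%N -> v i \in cell R N i) ->
    `|N%:R^-1 * \sum_(0 <= i < N) u (v i) - I| < eps / 2.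
  move=> vP; have width i : (i < N)%N -> nth 1 xs i - nth 1 (0 :: xs) i = N%:R^-1.
    move=> iN; rewrite -[nth 1 xs i]/(nth 1 (0 :: xs) i.+1) !nth_xs ?(ltnW iN)//.
    by rewrite -mulrBl -natrB// subSnn mul1r.
  have := Hd xs v xsP; rewrite size_mkseq /=.
  rewrite (_ : \sum_(0 <= i < N) _ = N%:R^-1 * \sum_(0 <= i < N) u (v i)).
    apply=> i iN; rewrite width//.
    rewrite -[nth 1 xs i]/(nth 1 (0 :: xs) i.+1) !nth_xs ?(ltnW iN)//.
    by split=> //; have := vP _ iN; rewrite in_itv.
  by rewrite mulr_sumr; apply: eq_big_nat => i /= iN; rewrite width// mulrC.
have c1 := close (fun i => (t i).1) (fun i iN => (At i iN).1).
have c2 := close (fun i => (t i).2) (fun i iN => (At i iN).2).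
rewrite -ler_pdivrMl// sumrB mulrBr.
move: c1 c2; rewrite !ltr_distl => /andP[_ c1] /andP[c2 _]; lra.
Qed.

End Darboux.

(** * Lower sums and the Lebesgue integral *)

Section CountableSuprema.
Context d (T : measurableType d) (R : realType).
Local Open Scope ereal_scope.

Lemma measurable_fun_ereal_sup (D : set T) (f : (T -> \bar R)^nat) :
  (forall n, measurable_fun D (f n)) ->
  measurable_fun D (fun x => ereal_sup (range (f ^~ x))).
Proof.
move=> mf; rewrite (_ : (fun _ => _) = fun x => esups (f ^~ x) 0%N); last first.
  by apply/funext => x; rewrite /esups /=; congr (ereal_sup _);
    apply/seteqP; split=> [_ [n _ <-]|_ [n _ <-]]; exists n.
exact: measurable_fun_esups.
Qed.

Lemma integral_ereal_sup (mu : {measure set T -> \bar R}) (D : set T)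
    (f : (T -> \bar R)^nat) : measurable D ->
  (forall n, measurable_fun D (f n)) ->
  (forall n x, D x -> 0 <= f n x) ->
  (forall x, D x -> nondecreasing_seq (f ^~ x)) ->
  \int[mu]_(x in D) ereal_sup (range (f ^~ x)) =
  ereal_sup (range (fun n => \int[mu]_(x in D) f n x)).
Proof.
move=> mD mf f0 fnd.
have nd : nondecreasing_seq (fun n => \int[mu]_(x in D) f n x).
  by move=> m n mn; apply: ge0_le_integral => // [x Dx|x Dx]; [exact: f0|exact: fnd].
have /cvg_lim <- // := ereal_nondecreasing_cvgn nd.
rewrite -monotone_convergence//; apply: eq_integral => x /set_mem Dx.
by have /cvg_lim -> := ereal_nondecreasing_cvgn (fnd x Dx).
Qed.

End CountableSuprema.

Section LowerSums.
Variable R : realType.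
Implicit Types (h k : R -> \bar R) (N n : nat) (xi : R).
Local Open Scope ereal_scope.

Definition lower_sum h N : \bar R :=
  (N%:R^-1)%:E * \sum_(0 <= i < N) cell_inf h N i.

Lemma lower_sumE h N : (0 < N)%N -> (forall xi, (0 <= xi <= 1)%R -> 0 <= h xi) ->
  lower_sum h N =
  \int[lebesgue_measure]_(xi in `[0%R, 1%R[) step N (cell_inf h N) xi.
Proof.
by move=> N0 h0; rewrite integral_step// => i iN; exact: cell_inf_ge0.
Qed.

Lemma lower_sum_ge0 h N : (forall xi, (0 <= xi <= 1)%R -> 0 <= h xi) ->
  0 <= lower_sum h N.
Proof.
move=> h0; rewrite mule_ge0 ?lee_fin ?invr_ge0//.
rewrite big_nat_cond sume_ge0// => i /andP[/= iN _].
exact: cell_inf_ge0.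
Qed.

Lemma lower_sum_refine h N q : (0 < N)%N -> (0 < q)%N ->
  (forall xi, (0 <= xi <= 1)%R -> 0 <= h xi) ->
  lower_sum h N <= lower_sum h (N * q).
Proof.
move=> N0 q0 h0; rewrite !lower_sumE ?muln_gt0 ?N0//.
apply: ge0_le_integral => //.
- by move=> xi _; apply: step_ge0 => i iN; exact: cell_inf_ge0.
- exact: measurable_step.
- exact: measurable_step.
- by move=> xi; rewrite /= in_itv; exact: step_cell_inf_refine.
Qed.

(** The comparison passes through the step function of the lower sum, which is measurable and lies
    below [h], hence below [k]. *)
Lemma lower_sum_le_integral h k N : (0 < N)%N ->
  (forall xi, (0 <= xi <= 1)%R -> 0 <= h xi <= k xi) ->
  measurable_fun (`[0%R, 1%R]%classic : set R) k ->
  lower_sum h N <= \int[lebesgue_measure]_(xi in `[0%R, 1%R]) k xi.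
Proof.
move=> N0 hk mk; have h0 xi : (0 <= xi <= 1)%R -> 0 <= h xi by move=> /hk/andP[].
have mk' : measurable_fun (`[0%R, 1%R[%classic : set R) k.
  by apply: measurable_funS mk => //; exact: subset_itv_co_cc.
(* The endpoint [1] is a null set; without it the half-open cells cover the domain. *)
rewrite -integral_itv_bndo_bndc//.
rewrite lower_sumE//; apply: ge0_le_integral => //.
- by move=> xi _; apply: step_ge0 => i iN; exact: cell_inf_ge0.
- exact: measurable_step.
- move=> xi; rewrite /= in_itv /= => xi01.
  have [j jN xij] := hcell_cover N0 xi01.
  have /andP[x0 x1] := xi01; have xc : (0 <= xi <= 1)%R by rewrite x0 ltW.
  rewrite (step_hcell _ jN xij) (le_trans (cell_inf_le _ (hcell_cell xij)))//.
  by have /andP[] := hk _ xc.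
Qed.

(* Each [h n] lies between its lower step function and the latter plus the step
   function of its oscillations. These have integrals tending to [0], so that
   [h n] is almost everywhere below the limit of the lower step functions,
   although it need not be Borel measurable itself. *)
Lemma integral_sup_le_lower_sum (h : nat -> R -> \bar R) k :
  (forall n xi, (0 <= xi <= 1)%R -> 0 <= h n xi) ->
  (forall n xi, (0 <= xi <= 1)%R -> h n xi \is a fin_num) ->
  (forall xi, (0 <= xi <= 1)%R -> nondecreasing_seq (h ^~ xi)) ->
  (forall n, riemann_integrable 0 1 (fine \o h n)) ->
  (forall xi, (0 <= xi <= 1)%R -> 0 <= k xi <= ereal_sup (range (h ^~ xi))) ->
  measurable_fun (`[0%R, 1%R]%classic : set R) k ->
  \int[lebesgue_measure]_(xi in `[0%R, 1%R]) k xi <=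
  ereal_sup (range (fun n => lower_sum (h n) (2 ^ n))).
Proof.
move=> h0 hfin hnd hR hk mk.
have pow_gt0 n : (0 < 2 ^ n)%N by rewrite expn_gt0.
have mk' : measurable_fun (`[0%R, 1%R[%classic : set R) k.
  by apply: measurable_funS mk => //; exact: subset_itv_co_cc.
rewrite -integral_itv_bndo_bndc//.
pose l n := step (2 ^ n) (cell_inf (h n) (2 ^ n)).
have l0 n xi : 0 <= l n xi.
  by apply: step_ge0 => i iN; apply: cell_inf_ge0 => // *; exact: h0.
have l_nd xi : (0 <= xi < 1)%R -> nondecreasing_seq (l ^~ xi).
  move=> xi01; apply/nondecreasing_seqP => n.
  (* First [h n] grows to [h n.+1] on the same cells, then each cell is halved. *)
  apply: (@le_trans _ _ (step (2 ^ n) (cell_inf (h n.+1) (2 ^ n)) xi)).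
    have [j jN xij] := hcell_cover (pow_gt0 n) xi01.
    rewrite /l !(step_hcell _ jN xij).
    apply: le_ereal_inf_tmp => _ [z /= zj <-].
    by rewrite (le_trans (cell_inf_le _ zj))//; apply: hnd => //; exact: cell_sub01 zj.
  by rewrite /l expnSr; exact: step_cell_inf_refine.
(* [D n] is the infimum over [m >= n] of the oscillation step functions of [h n]. The restriction to
   [m >= n] is what later allows a comparison with [l m]. *)
pose D n xi := einfs (fun m => step (2 ^ m) (osc (fine \o h n) (2 ^ m)) xi) n.
have mD n : measurable_fun (`[0%R, 1%R[%classic : set R) (D n).
  by apply: measurable_fun_einfs => m; exact: measurable_step.
have D0 n xi : 0 <= D n xi.
  apply: le_ereal_inf_tmp => _ [m /= _ <-]; apply: step_ge0 => i.
  exact: osc_ge0.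
have DE n : \int[lebesgue_measure]_(xi in `[0%R, 1%R[) D n xi = 0.
  apply/eqP; rewrite eq_le integral_ge0 ?andbT//.
  apply/lee_addgt0Pr => e e0; rewrite add0e.
  have [M HM] := riemann_integrable_osc (hR n) e0.
  (* The index [maxn M n] is large enough for the oscillation bound and at least [n], so that it
     occurs in the infimum [D n]. *)
  have /HM : (M < 2 ^ maxn M n)%N.
    exact: leq_ltn_trans (leq_maxl M n) (ltn_expl _ _).
  apply: le_trans; rewrite -integral_step//; last by move=> i; exact: osc_ge0.
  apply: ge0_le_integral => //; [exact: mD|exact: measurable_step|].
  move=> xi _; apply: ereal_inf_lbound.
  exists (maxn M n) => /=; first exact: leq_maxr.
  by [].
(* A nonnegative function with integral [0] vanishes almost everywhere; one null set serves all the
   countably many [n]. *)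
have aeD : {ae lebesgue_measure, forall xi n, (0 <= xi < 1)%R -> D n xi = 0}.
  apply: ae_foralln => n.
  apply: (ae_eq_integral_abs lebesgue_measure _ (mD n)).1 => //.
  by rewrite -[RHS](DE n); apply: eq_integral => xi _; rewrite gee0_abs.
apply: (@le_trans _ _
  (\int[lebesgue_measure]_(xi in `[0%R, 1%R[) ereal_sup (range (l ^~ xi)))).
  apply: ae_ge0_le_integral => //.
  - move=> xi; rewrite /= in_itv /= => /andP[x0 x1].
    by have /andP[] : 0 <= k xi <= ereal_sup (range (h ^~ xi)) by rewrite hk// x0 ltW.
  - by move=> xi _; apply: le_ereal_sup_tmp; exists (l 0%N xi) => //; exists 0%N.
  - by apply: measurable_fun_ereal_sup => n; exact: measurable_step.
  apply: (@filterS _ _ (ae_filter_ringOfSetsType (@lebesgue_measure R)) _ _ _ aeD).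
  move=> xi Dxi xi01; have := xi01; rewrite /= in_itv /= => xi01'.
  have /andP[x0 x1] := xi01'; have xc : (0 <= xi <= 1)%R by rewrite x0 ltW.
  have /andP[_ /le_trans] := hk _ xc; apply; apply: ge_ereal_sup => _ [n _ <-].
  set L := ereal_sup _.
  have lL m : l m xi <= L by apply: ereal_sup_ubound; exists m.
  have L0 : 0 <= L by exact: le_trans (lL 0%N).
  have [->|Lfin] := eqVneq L +oo; first exact: leey.
  have {}Lfin : L \is a fin_num by rewrite ge0_fin_numE ?ltey.
  rewrite -[leRHS]adde0 -[X in _ + X](Dxi n xi01') -leeBlDl//.
  apply: le_ereal_inf_tmp => _ [m /= nm <-].
  have [j jN xij] := hcell_cover (pow_gt0 m) xi01'.
  have xcj := hcell_cell xij.
  rewrite (step_hcell _ jN xij).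
  (* As [n <= m], the infimum of [h n] on the cell is at most that of [h m], which is [l m xi]. *)
  have infL : cell_inf (h n) (2 ^ m) j <= L.
    apply: le_trans (lL m); rewrite /l (step_hcell _ jN xij).
    apply: le_ereal_inf_tmp => _ [z /= zj <-].
    by rewrite (le_trans (cell_inf_le _ zj))//; apply: hnd => //; exact: cell_sub01 zj.
  rewrite leeBlDl//; set w := osc _ _ _; have w0 : 0 <= w by exact: osc_ge0.
  have [->|wfin] := eqVneq w +oo; first by rewrite addey ?leey// -ltNye (lt_le_trans _ L0).
  have {}wfin : w \is a fin_num by rewrite ge0_fin_numE ?ltey.
  rewrite -leeBlDr//; apply: le_trans infL; apply: le_ereal_inf_tmp => _ [z /= zj <-].
  rewrite leeBlDl// -leeBlDr ?hfin ?(cell_sub01 jN zj)//.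
  rewrite -(fineK (hfin n _ xc)) -(fineK (hfin n _ (cell_sub01 jN zj))) -EFinB.
  by apply: ereal_sup_ubound; exists (xi, z).
rewrite integral_ereal_sup//; last by move=> n; exact: measurable_step.
apply: ge_ereal_sup => _ [n _ <-]; rewrite -lower_sumE//; last by move=> xi; exact: h0.
by apply: ereal_sup_ubound; exists n.
Qed.

End LowerSums.

(** * Continuous transformers *)

Section NatSuprema.
Variable R : realType.
Local Open Scope ereal_scope.
Implicit Types u v : (\bar R)^nat.

Lemma esup_ge u n : u n <= ereal_sup (range u).
Proof. by apply: ereal_sup_ubound; exists n. Qed.

Lemma esup_leP u x : (forall n, u n <= x) -> ereal_sup (range u) <= x.
Proof. by move=> ux; apply: ge_ereal_sup => _ [n _ <-]. Qed.

Lemma le_esup u v : (forall n, u n <= v n) -> ereal_sup (range u) <= ereal_sup (range v).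
Proof. by move=> uv; apply: esup_leP => n; exact: le_trans (esup_ge v n). Qed.

(** Both sides are the limit of the same monotone sequence; nonnegativity keeps the sum of the
    limits defined. *)
Lemma esup_convex (p q : R) u v : (0 <= p)%R -> (0 <= q)%R ->
  (forall n, 0 <= u n) -> (forall n, 0 <= v n) ->
  nondecreasing_seq u -> nondecreasing_seq v ->
  p%:E * ereal_sup (range u) + q%:E * ereal_sup (range v) =
  ereal_sup (range (fun n => p%:E * u n + q%:E * v n)).
Proof.
move=> p0 q0 u0 v0 ndu ndv.
have /cvg_lim <- // : (p%:E * u n + q%:E * v n) @[n --> \oo] -->
    ereal_sup (range (fun n => p%:E * u n + q%:E * v n)).
  apply: ereal_nondecreasing_cvgn => m n mn.
  by apply: leeD; apply: lee_wpmul2l; rewrite ?lee_fin//; [exact: ndu|exact: ndv].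
apply/esym/cvg_lim => //; apply: cvgeD.
- apply: ge0_adde_def; rewrite inE mule_ge0 ?lee_fin//.
    exact: le_trans (u0 0%N) (esup_ge u 0%N).
  exact: le_trans (v0 0%N) (esup_ge v 0%N).
- by apply: cvgeZl => //; exact: ereal_nondecreasing_cvgn.
- by apply: cvgeZl => //; exact: ereal_nondecreasing_cvgn.
Qed.

End NatSuprema.

Section Transformers.
Variables (R : realType) (V : finType).
Local Open Scope ereal_scope.
Local Notation expT := (expectationT R V).
Local Notation Exp := (@Exp R V).
Local Notation EM := (@Exp_meas R V).

Definition esup (h : nat -> expT) : expT := fun s => ereal_sup (range (h ^~ s)).

Lemma iverson_if b (x y : \bar R) :
  iverson R b * x + iverson R (~~ b) * y = if b then x else y.
Proof.
by case: b; rewrite /iverson /= mul1e mul0e ?adde0 ?add0e.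
Qed.

Lemma iverson_ifN b (x y : \bar R) :
  iverson R (~~ b) * x + iverson R b * y = if b then y else x.
Proof. by rewrite addeC iverson_if. Qed.

Lemma mix_prob (p : {i01 rat}) : (0 <= ratr p%:num :> R)%R /\ (0 <= 1 - ratr p%:num :> R)%R.
Proof.
rewrite subr_ge0 ler0q ge0; split=> //.
by rewrite -(rmorph1 (@ratr R)) ler_rat le1.
Qed.

Lemma Exp_meas_esup (h : nat -> expT) : (forall n, EM (h n)) -> EM (esup h).
Proof.
move=> Hh; split=> [s|]; first exact: le_trans ((Hh 0%N).1 s) (esup_ge (h ^~ s) 0%N).
by apply: measurable_fun_ereal_sup => n; exact: (Hh n).2.
Qed.

(** Scott continuity on measurable expectations. The last clause is only one inequality, since
    monotonicity yields the other. *)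
Definition continuous_transformer (T : expT -> expT) : Prop :=
  [/\ forall f, EM f -> EM (T f),
      forall f g, EM f -> EM g -> (forall s, f s <= g s) -> forall s, T f s <= T g s &
      forall h : nat -> expT, (forall n, EM (h n)) ->
        (forall s, nondecreasing_seq (h ^~ s)) ->
        forall s, T (esup h) s <= esup (fun n => T (h n)) s].

Lemma continuous_transformer_id : continuous_transformer id.
Proof. by split. Qed.

Lemma continuous_transformer_cst (c : \bar R) : 0 <= c ->
  continuous_transformer (fun=> cst c).
Proof.
move=> c0; split=> // [f _|h _ _ s]; first by split=> //; exact: measurable_cst.
exact: (esup_ge (fun=> c) 0%N).
Qed.

Lemma continuous_transformer_comp (T U : expT -> expT) :
  continuous_transformer T -> continuous_transformer U ->
  continuous_transformer (T \o U).
Proof.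
move=> [cT mT sT] [cU mU sU]; split=> /= [f ?|f g Hf Hg fg s|h Hh ndh s].
- by apply: cT; exact: cU.
- by apply: mT; [exact: cU|exact: cU|exact: mU].
have HU n : EM (U (h n)) by exact: cU.
apply: (@le_trans _ _ (T (esup (fun n => U (h n))) s)).
  apply: mT; [exact/cU/Exp_meas_esup|exact: Exp_meas_esup|exact: sU].
by apply: sT => // t m n mn; apply: mU => // r; exact: ndh.
Qed.

Lemma continuous_transformer_if (phi : guard R V) (T U : expT -> expT) :
  continuous_transformer T -> continuous_transformer U ->
  continuous_transformer (fun f s => if phi s then T f s else U f s).
Proof.
move=> [cT mT sT] [cU mU sU]; split=> /= [f Hf|f g Hf Hg fg s|h Hh ndh s].
- have [T0 mTf] := cT f Hf; have [U0 mUf] := cU f Hf.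
  split=> [s|]; first by case: ifP.
  by apply: measurable_fun_ifT.
- by case: ifP => _; [exact: mT|exact: mU].
- by rewrite /esup; case: ifP => _; [exact: sT|exact: sU].
Qed.

Lemma continuous_transformer_mix (p q : R) (T U : expT -> expT) :
  (0 <= p)%R -> (0 <= q)%R ->
  continuous_transformer T -> continuous_transformer U ->
  continuous_transformer (fun f s => p%:E * T f s + q%:E * U f s).
Proof.
move=> p0 q0 [cT mT sT] [cU mU sU]; split=> /= [f Hf|f g Hf Hg fg s|h Hh ndh s].
- have [T0 mTf] := cT f Hf; have [U0 mUf] := cU f Hf.
  split=> [s|]; first by rewrite adde_ge0// mule_ge0.
  by apply: emeasurable_funD; exact: measurable_funeM.
- by apply: leeD; apply: lee_wpmul2l; rewrite ?lee_fin//; [exact: mT|exact: mU].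
- rewrite /esup -esup_convex//.
  + by apply: leeD; apply: lee_wpmul2l; rewrite ?lee_fin//; [exact: sT|exact: sU].
  + by move=> n; exact: (cT _ (Hh n)).1.
  + by move=> n; exact: (cU _ (Hh n)).1.
  + by move=> m n mn; apply: mT => // t; exact: ndh.
  + by move=> m n mn; apply: mU => // t; exact: ndh.
Qed.

Lemma continuous_transformer_subst (x : V) (e : aexp R V) :
  continuous_transformer (fun f s => f (upd s x (e s))).
Proof.
split=> [f [f0 mf]|f g _ _ fg s|h _ _ s //]; last exact: fg.
split=> [s|]; first exact: f0.
exact: measurableT_comp mf (measurable_upd x e).
Qed.

(** Two suprema are interchanged. This serves loops, whose semantics is the supremum of the Kleene
    iterates. *)
Lemma continuous_transformer_esup (T : nat -> expT -> expT) :
  (forall j, continuous_transformer (T j)) ->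
  continuous_transformer (fun f => esup (fun j => T j f)).
Proof.
move=> HT; split=> [f Hf|f g Hf Hg fg s|h Hh ndh s].
- by apply: Exp_meas_esup => j; have [+ _ _] := HT j; exact.
- by apply: le_esup => j; have [_ + _] := HT j; exact.
- apply: esup_leP => j; have [_ _ /(_ h Hh ndh s)/le_trans] := HT j; apply.
  by apply: le_esup => n; exact: (esup_ge (fun j => T j (h n) s)).
Qed.

Lemma measurable_slice (f : expT) (s : state R V) (x : V) : EM f ->
  measurable_fun setT (fun xi : R => f (updr s x xi)).
Proof. by move=> [_ mf]; exact: measurableT_comp mf (measurable_updr_slice s x). Qed.

Lemma continuous_transformer_unif (x : V) : continuous_transformer (@unif_int R V x).
Proof.
split=> [f Hf|f g Hf Hg fg s|h Hh ndh s].
- split=> [s|]; first by apply: integral_ge0 => xi _; exact: Hf.1.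
  pose D : set R := `[0%R, 1%R]%classic.
  (* Tonelli's theorem gives measurability in [s] for integrals over the whole line, hence the
     indicator of [[0, 1]]. *)
  pose F (p : state R V * R) := f (updr p.1 x p.2) * (\1_D p.2)%:E.
  rewrite (_ : unif_int x f =
      fun s => \int[lebesgue_measure]_xi F (s, xi)); last first.
    apply/funext => s; rewrite /unif_int integral_mkcond.
    apply: eq_integral => xi _; rewrite /F patchE indicE /D.
    by case: ifPn => xiD; rewrite ?mule1 ?mule0.
  apply: (measurable_fun_fubini_tonelli_F (m2 := @lebesgue_measure R) F).
    apply: emeasurable_funM.
      exact: measurableT_comp Hf.2 (measurable_updr x).
    apply/measurable_EFinP.
    have mD : measurable_fun setT (\1_D : R -> R).
      by apply: measurable_indic; exact: measurable_itv.
    exact: measurableT_comp mD measurable_snd.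
  by move=> p; rewrite mule_ge0 ?lee_fin ?indicE//; exact: Hf.1.
- apply: ge0_le_integral => //.
  + by move=> xi _; exact: Hf.1.
  + exact: measurable_funTS (measurable_slice s x Hf).
  + exact: measurable_funTS (measurable_slice s x Hg).
- rewrite /unif_int /esup integral_ereal_sup// => [n|n xi _].
  + exact: measurable_funTS (measurable_slice s x (Hh n)).
  + exact: (Hh n).1.
Qed.

End Transformers.

(** * Semantics with a value for failed observations *)

Section GeneralizedSemantics.
Variables (R : realType) (V : finType).
Variables (E : set (aexp R V)) (G : set (guard R V)).
Local Open Scope ereal_scope.
Local Notation expT := (expectationT R V).
Local Notation Exp := (@Exp R V).
Local Notation EM := (@Exp_meas R V).
Implicit Types (C B : pWhile E G) (f g h k : expT) (N l n j : nat).

Variable c : \bar R.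

(* The value [c] is returned when an observation fails: [c = 0] gives wp, and
   [c = 1] gives [1 - wlp] of the complement [1 - g]. *)
Fixpoint csem (u : V -> expT -> expT) C : expT -> expT :=
  match C with
  | Skip => id
  | Diverge => fun=> cst 0
  | Assign x e _ => fun f s => f (upd s x (e s))
  | Observe phi _ => fun f s => if phi s then f s else c
  | Unif x => u x
  | If phi _ C1 C2 => fun f s => if phi s then csem u C1 f s else csem u C2 f s
  | PChoice p C1 C2 => fun f s =>
      (ratr p%:num)%:E * csem u C1 f s + (1 - ratr p%:num)%R%:E * csem u C2 f s
  | Seq C1 C2 => csem u C1 \o csem u C2
  | While phi _ B => fun f => esup (fun j =>
      iter j (fun Y s => if phi s then csem u B Y s else f s) (cst 0))
  end.

Definition sem : pWhile E G -> expT -> expT := csem (@unif_int R V).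

(** The sampling resolution [N] and the unrolling depth [l] are kept apart because the loop argument
    raises the depth alone. *)
Definition approx N l C : expT -> expT := csem (@unif_lower R V N) (unroll C l).

Lemma approx_WhileS N l (phi : guard R V) (Gphi : G phi) B f :
  approx N l.+1 (While Gphi B) f = fun s =>
    if phi s then approx N l B (approx N l (While Gphi B) f) s else f s.
Proof. by []. Qed.

Hypothesis c0 : 0 <= c.

Definition body (phi : guard R V) B f (Y : expT) : expT :=
  fun s => if phi s then sem B Y s else f s.

Lemma continuous_transformer_iter (phi : guard R V) B j :
  continuous_transformer (sem B) ->
  continuous_transformer (fun f => iter j (body phi B f) (cst 0)).
Proof.
move=> cB; elim: j => [|j ih]; first exact: continuous_transformer_cst.
exact: continuous_transformer_if (continuous_transformer_comp cB ih)
  (@continuous_transformer_id R V).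
Qed.

Lemma continuous_transformer_sem C : continuous_transformer (sem C).
Proof.
elim: C => [||x e ?|phi ?|x|phi ? C1 ih1 C2 ih2|p C1 ih1 C2 ih2|
  C1 ih1 C2 ih2|phi ? B ih] .
- exact: continuous_transformer_id.
- exact: continuous_transformer_cst.
- exact: continuous_transformer_subst.
- exact: continuous_transformer_if (@continuous_transformer_id R V)
    (continuous_transformer_cst V c0).
- exact: continuous_transformer_unif.
- exact: continuous_transformer_if.
- by have [p0 p1] := mix_prob R p; exact: continuous_transformer_mix.
- exact: continuous_transformer_comp.
- by apply: continuous_transformer_esup => j; exact: continuous_transformer_iter.
Qed.

Lemma Exp_meas_sem C f : EM f -> EM (sem C f).
Proof. by have [+ _ _] := continuous_transformer_sem C; exact. Qed.

Lemma le_sem C f g : EM f -> EM g -> (forall s, f s <= g s) ->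
  forall s, sem C f s <= sem C g s.
Proof. by have [_ + _] := continuous_transformer_sem C; exact. Qed.

Lemma Exp_meas_iter (phi : guard R V) B f j :
  EM f -> EM (iter j (body phi B f) (cst 0)).
Proof.
have [+ _ _] := continuous_transformer_iter phi j (continuous_transformer_sem B).
exact.
Qed.

Lemma le_body (phi : guard R V) B f Y Z : EM Y -> EM Z ->
  (forall s, Y s <= Z s) -> forall s, body phi B f Y s <= body phi B f Z s.
Proof. by move=> HY HZ YZ s; rewrite /body; case: ifP => _ //; exact: le_sem. Qed.

Lemma body_ge0 (phi : guard R V) B f Y s : EM f -> EM Y -> 0 <= body phi B f Y s.
Proof.
by move=> Hf HY; rewrite /body; case: ifP => _; [exact: (Exp_meas_sem B HY).1|exact: Hf.1].
Qed.

Lemma nondecreasing_iter (phi : guard R V) B f s : EM f ->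
  nondecreasing_seq (fun j => iter j (body phi B f) (cst 0) s).
Proof.
move=> Hf; apply/nondecreasing_seqP => j; elim: j s => [|j ih] s /=.
  exact: (Exp_meas_iter phi B 1 Hf).1.
apply: le_body => //; first exact: Exp_meas_iter.
exact: (Exp_meas_iter phi B j.+1 Hf).
Qed.

(** Kleene's argument: each iterate is the body applied to its predecessor, and continuity of
    [sem B] moves the supremum of the iterates out of the body, where the index shifts by one. *)
Lemma sem_While_fixpoint (phi : guard R V) (Gphi : G phi) B f : EM f ->
  sem (While Gphi B) f = body phi B f (sem (While Gphi B) f).
Proof.
move=> Hf; have HW := Exp_meas_sem (While Gphi B) Hf.
apply/funext => s; apply/eqP; rewrite eq_le; apply/andP; split.
  apply: esup_leP => -[|j]; first exact: body_ge0.
  apply: le_body => //; first exact: Exp_meas_iter.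
  by move=> t; exact: (esup_ge (fun j => iter j (body phi B f) (cst 0) t) j).
rewrite {1}/body; case: ifPn => phis.
  have [_ _ cB] := continuous_transformer_sem B.
  apply: le_trans (cB _ (fun j => Exp_meas_iter phi B j Hf) _ s) _.
    by move=> t; exact: nondecreasing_iter.
  apply: esup_leP => j; apply: le_trans (esup_ge _ j.+1).
  by rewrite /= /body phis.
apply: le_trans (esup_ge _ 1%N).
by rewrite /= (negbTE phis).
Qed.

(** Park induction: by monotonicity every iterate stays below a pre-fixed point. *)
Lemma sem_While_least (phi : guard R V) (Gphi : G phi) B f Z :
  EM f -> EM Z -> (forall s, body phi B f Z s <= Z s) ->
  forall s, sem (While Gphi B) f s <= Z s.
Proof.
move=> Hf HZ ZP s; apply: esup_leP => j; elim: j s => [|j ih] s.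
  exact: HZ.1.
by apply: le_trans (ZP s); apply: le_body => //; exact: Exp_meas_iter.
Qed.

Lemma unif_lowerE N x f s :
  unif_lower N x f s = lower_sum (fun xi => f (updr s x xi)) N.
Proof. by []. Qed.

Lemma le_lower_sum (f g : R -> \bar R) N : (forall xi, f xi <= g xi) ->
  lower_sum f N <= lower_sum g N.
Proof.
move=> fg; apply: lee_wpmul2l; first by rewrite lee_fin invr_ge0.
apply: lee_sum => i _; apply: le_ereal_inf_tmp => _ [xi xi_i <-].
exact: le_trans (cell_inf_le _ xi_i) (fg xi).
Qed.

Lemma approx_ge0 N l C f : Exp f -> Exp (approx N l C f).
Proof.
elim: C l f => [||x e ?|phi ?|x|phi ? C1 ih1 C2 ih2|p C1 ih1 C2 ih2|
  C1 ih1 C2 ih2|phi Gphi B ih] l f f0 s //.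
- exact: f0.
- by rewrite /approx /=; case: ifP.
- by rewrite /approx /= unif_lowerE; apply: lower_sum_ge0.
- by rewrite /approx /=; case: ifP => _; [exact: ih1|exact: ih2].
- have [p0 p1] := mix_prob R p.
  by rewrite adde_ge0// mule_ge0// ?lee_fin//; [exact: ih1|exact: ih2].
- by rewrite /approx /=; apply: ih1; exact: ih2.
- elim: l s => [//|l ihl] s; rewrite approx_WhileS; case: ifP => _ //.
  exact: ih.
Qed.

(** Monotonicity in resolution, depth and post-expectation is proved jointly, because in sequences
    and loops the inner approximation is the post-expectation of the outer one. The resolution grows
    along divisibility, so that partitions refine. *)
Lemma le_approx N q l l' C f g : (0 < N)%N -> (0 < q)%N -> (l <= l')%N ->
  Exp f -> Exp g -> (forall s, f s <= g s) ->
  forall s, approx N l C f s <= approx (N * q) l' C g s.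
Proof.
move=> N0 q0.
elim: C l l' f g => [||x e ?|phi ?|x|phi ? C1 ih1 C2 ih2|p C1 ih1 C2 ih2|
  C1 ih1 C2 ih2|phi Gphi B ih] l l' f g ll' f0 g0 fg s //.
- exact: fg.
- by rewrite /approx /=; case: ifP.
- rewrite /approx /= !unif_lowerE.
  by apply: (le_trans (le_lower_sum N (fun xi => fg _))); apply: lower_sum_refine.
- by rewrite /approx /=; case: ifP => _; [exact: ih1|exact: ih2].
- have [p0 p1] := mix_prob R p.
  by apply: leeD; apply: lee_wpmul2l; rewrite ?lee_fin//; [exact: ih1|exact: ih2].
- rewrite /approx /=; apply: ih1 => //; [exact: approx_ge0|exact: approx_ge0|].
  exact: ih2.
- elim: l l' ll' s => [|l ihl] [|l'] // ll' s.
    by apply: approx_ge0.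
  rewrite !approx_WhileS; case: ifP => _ //.
  by apply: ih => //; [exact: approx_ge0|exact: approx_ge0|exact: ihl].
Qed.

(** Two post-expectations appear because the approximation of an inner program may fail to be
    measurable, while its semantics is a measurable bound above it. *)
Lemma approx_le_sem N l C f g : (0 < N)%N -> Exp f -> EM g ->
  (forall s, f s <= g s) -> forall s, approx N l C f s <= sem C g s.
Proof.
move=> N0.
elim: C l f g => [||x e ?|phi ?|x|phi ? C1 ih1 C2 ih2|p C1 ih1 C2 ih2|
  C1 ih1 C2 ih2|phi Gphi B ih] l f g f0 g0 fg s //.
- exact: fg.
- by rewrite /approx /sem /=; case: ifP.
- rewrite /approx /= unif_lowerE; apply: lower_sum_le_integral => //.
    by move=> xi _; rewrite f0 fg.
  exact: measurable_funTS (measurable_slice s x g0).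
- by rewrite /approx /sem /=; case: ifP => _; [exact: ih1|exact: ih2].
- have [p0 p1] := mix_prob R p.
  by apply: leeD; apply: lee_wpmul2l; rewrite ?lee_fin//; [exact: ih1|exact: ih2].
- rewrite /approx /sem /=; apply: ih1 => //; [exact: approx_ge0|exact: Exp_meas_sem|].
  exact: ih2.
- elim: l s => [|l ihl] s; first exact: (Exp_meas_sem _ g0).1.
  rewrite approx_WhileS sem_While_fixpoint// /body; case: ifP => _ //.
  by apply: ih => //; [exact: approx_ge0|exact: Exp_meas_sem].
Qed.

End GeneralizedSemantics.

(** * Convergence of the approximations *)

Section Convergence.
Variables (R : realType) (V : finType).
Variables (E : set (aexp R V)) (G : set (guard R V)) (F : set (expectationT R V)).
Hypothesis HF : riemann_suitable E G F.
Local Open Scope ereal_scope.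
Local Notation expT := (expectationT R V).
Implicit Types (C B : pWhile E G) (f g : expT) (h : nat -> expT).

Lemma suitable_ite f g (phi : guard R V) : F f -> F g -> G phi ->
  F (fun s => if phi s then f s else g s).
Proof.
move=> Ff Fg Gphi; have := suitable_if HF Ff Fg Gphi.
by congr F; apply/funext => s; rewrite iverson_if.
Qed.

(** By induction: the average of [n + 2] functions mixes the average of the first [n + 1] with the
    last one, with the rational weight [(n + 1) / (n + 2)]. *)
Lemma suitable_average (f : nat -> expT) n : (forall i, (i <= n)%N -> F (f i)) ->
  F (fun s => (n.+1%:R^-1)%:E * \sum_(0 <= i < n.+1) f i s).
Proof.
elim: n => [|n ih] Ff.
  have := Ff 0%N (leqnn _); congr F; apply/funext => s.
  by rewrite big_nat1 invr1 mul1e.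
have q0 : (0 <= n.+1%:R / n.+2%:R :> rat)%R by rewrite divr_ge0.
have q1 : (n.+1%:R / n.+2%:R <= 1 :> rat)%R.
  by rewrite ler_pdivrMr ?ltr0n// mul1r ler_nat.
have := suitable_mix HF (Itv01 q0 q1) (ih (fun i iN => Ff i (leqW iN)))
  (Ff n.+1 (leqnn _)).
congr F; apply/funext => s /=.
rewrite [in RHS]big_nat_recr//= ge0_muleDr; last 2 first.
- rewrite big_nat_cond sume_ge0// => i /andP[/= iN _].
  by apply: (suitable_F_exp HF); apply: Ff; exact: ltnW.
- by apply: (suitable_F_exp HF); exact: Ff.
rewrite muleA -EFinM.
have -> : (ratr (n.+1%:R / n.+2%:R) = n.+1%:R / n.+2%:R :> R)%R.
  by rewrite rmorphM fmorphV !rmorph_nat.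
congr (_%:E * _ + _%:E * _).
  by rewrite mulrAC divff ?mul1r// pnatr_eq0.
rewrite -[X in (X - _)%R](@divff _ (n.+2%:R : R)) ?pnatr_eq0//.
by rewrite -mulrBl -natrB// subSnn mul1r.
Qed.

Lemma suitable_unif_lower f x N : (0 < N)%N -> F f -> F (unif_lower N x f).
Proof.
case: N => // n _ Ff.
apply: (@suitable_average (fun i => inf_on (i%:R / n.+1%:R)%R (i.+1%:R / n.+1%:R)%R x f)).
move=> i iN; apply: (suitable_inf HF); first exact: Ff.
- by rewrite divr_ge0.
- by rewrite ler_pM2r ?invr_gt0 ?ltr0n// ler_nat.
- by rewrite ler_pdivrMr ?ltr0n// mul1r ler_nat.
Qed.

Variable c : \bar R.
Hypotheses (c0 : 0 <= c) (Fc : F (cst c)).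

(** Staying in [F] keeps the approximations Riemann-integrable in each variable, as sampling
    requires of its post-expectations. *)
Lemma suitable_approx N l C f : (0 < N)%N -> F f -> F (approx c N l C f).
Proof.
move=> N0.
elim: C l f => [||x e ?|phi ?|x|phi ? C1 ih1 C2 ih2|p C1 ih1 C2 ih2|
  C1 ih1 C2 ih2|phi Gphi B ih] l f Ff //.
- exact: suitable_0 HF.
- exact: (suitable_subst HF).
- exact: suitable_ite.
- exact: suitable_unif_lower.
- by apply: suitable_ite => //; [exact: ih1|exact: ih2].
- by apply: (suitable_mix HF); [exact: ih1|exact: ih2].
- by apply: ih1; exact: ih2.
- elim: l => [|l ihl]; first exact: suitable_0 HF.
  by rewrite approx_WhileS; apply: suitable_ite => //; exact: ih.
Qed.

(** Resolutions that are powers of two divide each other, which makes this sequence increasing in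
    [n]. *)
Definition dyadic_approx n C : expT -> expT := approx c (2 ^ n) n C.

Lemma le_dyadic_approx m n C f g : (m <= n)%N -> Exp f -> Exp g ->
  (forall s, f s <= g s) -> forall s, dyadic_approx m C f s <= dyadic_approx n C g s.
Proof.
move=> mn f0 g0 fg s; rewrite /dyadic_approx -(subnKC mn) expnD.
by apply: le_approx => //; rewrite ?expn_gt0// leq_addr.
Qed.

Definition chain h : Prop :=
  (forall n, F (h n)) /\ (forall s, nondecreasing_seq (h ^~ s)).

Lemma chain_dyadic_approx C h : chain h -> chain (fun n => dyadic_approx n C (h n)).
Proof.
move=> [Fh ndh]; split=> [n|s m n mn]; first by apply: suitable_approx; rewrite ?expn_gt0.
apply: le_dyadic_approx => //; try exact: (suitable_F_exp HF).
by move=> t; exact: ndh.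
Qed.

Lemma chain_Exp h n : chain h -> Exp (h n).
Proof. by move=> [Fh _]; exact: (suitable_F_exp HF). Qed.

Lemma Exp_esup h : chain h -> Exp (esup h).
Proof.
by move=> ch s; exact: le_trans (chain_Exp 0%N ch s) (esup_ge (h ^~ s) 0%N).
Qed.

(** The induction statement concerns chains: in a sequence, the first program meets the
    approximations of the second as post-expectations, and measurability is available for their
    supremum only. *)
Definition approximable C : Prop := forall h, chain h -> meas (esup h) ->
  sem c C (esup h) = esup (fun n => dyadic_approx n C (h n)).

Lemma approximableP C :
  (forall h, chain h -> meas (esup h) ->
    forall s, sem c C (esup h) s <= esup (fun n => dyadic_approx n C (h n)) s) ->
  approximable C.
Proof.
move=> HC h ch mh; apply/funext => s; apply/eqP; rewrite eq_le HC//=.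
apply: esup_leP => n; apply: approx_le_sem => //; first by rewrite expn_gt0.
- exact: chain_Exp.
- by split=> //; exact: Exp_esup.
- by move=> t; exact: (esup_ge (h ^~ t) n).
Qed.

(** The approximations of [C2] form a chain whose supremum is [sem c C2 (esup h)], hence measurable,
    so the hypothesis on [C1] applies to it. *)
Lemma approximable_Seq C1 C2 :
  approximable C1 -> approximable C2 -> approximable (Seq C1 C2).
Proof.
move=> ap1 ap2 h ch mh; have ch2 := chain_dyadic_approx C2 ch.
have e2 := ap2 h ch mh.
rewrite -[LHS]/(sem c C1 (sem c C2 (esup h))) e2 ap1// -e2.
by apply: (Exp_meas_sem c0 _ _).2; split=> //; exact: Exp_esup.
Qed.

Lemma approximable_Unif x : approximable (Unif x).
Proof.
apply: approximableP => h ch mh s; have [Fh ndh] := ch.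
apply: (@integral_sup_le_lower_sum R (fun n xi => h n (updr s x xi))).
- by move=> n xi _; exact: chain_Exp.
- by move=> n xi xi01; have [+ _] := suitable_F_integrable HF x (Fh n) s; exact.
- by move=> xi _; exact: ndh.
- by move=> n; have [_ +] := suitable_F_integrable HF x (Fh n) s.
- by move=> xi _; rewrite lexx andbT; exact: Exp_esup.
- exact: measurable_funTS (measurable_slice s x (conj (Exp_esup ch) mh)).
Qed.

(** The [j]-th Kleene iterate of the loop with its body approximated at order [n]; [j] and [n] vary
    independently. *)
Definition loop_approx (phi : guard R V) B h j n : expT :=
  iter j (fun Y s => if phi s then dyadic_approx n B Y s else h n s) (cst 0).

Lemma chain_loop_approx (phi : guard R V) B h j : G phi -> chain h ->
  chain (loop_approx phi B h j).
Proof.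
move=> Gphi ch; elim: j => [|j ih]; first by split=> [n|s m n _ //]; exact: (suitable_0 HF).
have [Fa nda] := chain_dyadic_approx B ih; have [Fh ndh] := ch.
split=> [n|s m n mn]; first exact: suitable_ite (Fa n) (Fh n) Gphi.
by rewrite /loop_approx /=; case: ifP => _; [exact: nda|exact: ndh].
Qed.

(** By induction on [j]: the supremum at stage [j] is an exact iterate and therefore measurable, so
    [approximable B] applies to the chain at that stage. *)
Lemma esup_loop_approx (phi : guard R V) B h j : G phi -> approximable B ->
  chain h -> meas (esup h) ->
  esup (loop_approx phi B h j) = iter j (body c phi B (esup h)) (cst 0).
Proof.
move=> Gphi apB ch mh; elim: j => [|j ih].
  apply/funext => s; apply/eqP; rewrite eq_le; apply/andP; split.
    exact: esup_leP.
  exact: (esup_ge (fun n => loop_approx phi B h 0 n s) 0%N).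
have mloop : meas (esup (loop_approx phi B h j)).
  by rewrite ih; apply: (Exp_meas_iter c0 _ _ _ _).2; split=> //; exact: Exp_esup.
rewrite iterS -ih /body (apB _ (chain_loop_approx B j Gphi ch) mloop).
by apply/funext => s; rewrite /loop_approx /esup /=; case: ifP.
Qed.

(** The unrolling of depth [n + j] performs at least [j] rounds, and in the first [j] of them the
    body has depth at least [n]. *)
Lemma loop_approx_le (phi : guard R V) (Gphi : G phi) B h j n s : chain h ->
  loop_approx phi B h j n s <= approx c (2 ^ n) (n + j) (While Gphi B) (h n) s.
Proof.
move=> ch; elim: j s => [|j ih] s; first by apply: approx_ge0 => //; exact: chain_Exp.
rewrite addnS approx_WhileS /loop_approx /=; case: ifP => _ //.
rewrite -[X in approx _ X _ B]muln1; apply: le_approx; rewrite ?expn_gt0 ?leq_addr//.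
- exact: (chain_Exp n (chain_loop_approx B j Gphi ch)).
- by apply: approx_ge0 => //; exact: chain_Exp.
Qed.

(** The loop is a double supremum over iterates [j] and orders [n]; the term at [(j, n)] is absorbed
    by the dyadic approximation of order [n + j]. *)
Lemma approximable_While (phi : guard R V) (Gphi : G phi) B :
  approximable B -> approximable (While Gphi B).
Proof.
move=> apB; apply: approximableP => h ch mh s.
apply: esup_leP => j; rewrite -(esup_loop_approx j Gphi apB ch mh).
apply: esup_leP => n; apply: le_trans (esup_ge _ (n + j)%N).
apply: (le_trans (loop_approx_le Gphi B j n s ch)).
rewrite /dyadic_approx expnD; apply: le_approx; rewrite ?expn_gt0//.
- exact: chain_Exp.
- exact: chain_Exp.
- by move=> t; have [_ ndh] := ch; apply: ndh; exact: leq_addr.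
Qed.

Lemma approximable_all C : approximable C.
Proof.
elim: C => [||x e ?|phi ?|x|phi ? C1 ih1 C2 ih2|p C1 ih1 C2 ih2|
  C1 ih1 C2 ih2|phi Gphi B ih] .
- by [].
- by apply: approximableP => h ch _ s; exact: (esup_ge (fun=> 0) 0%N).
- by [].
- apply: approximableP => h ch _ s; rewrite /sem /dyadic_approx /approx /esup /=.
  by case: ifP => // _; exact: (esup_ge (fun=> c) 0%N).
- exact: approximable_Unif.
- move=> h ch mh; apply/funext => s.
  have e1 := congr1 (fun k => k s) (ih1 h ch mh).
  have e2 := congr1 (fun k => k s) (ih2 h ch mh).
  by rewrite /sem /dyadic_approx /approx /esup /= in e1 e2 *; case: ifP.
- move=> h ch mh; apply/funext => s; have [p0 p1] := mix_prob R p.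
  have e1 := congr1 (fun k => k s) (ih1 h ch mh).
  have e2 := congr1 (fun k => k s) (ih2 h ch mh).
  rewrite /sem /= -![csem _ _ _ _ _]/(sem c _ _ _) e1 e2 /esup esup_convex//.
  + by move=> n; exact: (chain_Exp n (chain_dyadic_approx _ ch)).
  + by move=> n; exact: (chain_Exp n (chain_dyadic_approx _ ch)).
  + exact: (chain_dyadic_approx C1 ch).2.
  + exact: (chain_dyadic_approx C2 ch).2.
- exact: approximable_Seq.
- exact: approximable_While.
Qed.

(** The result on chains is applied to the constant chain [f]. It remains to compare the dyadic
    sequence with the terms whose resolution equals their depth. *)
Theorem esup_approx C f : F f -> meas f ->
  (fun s => ereal_sup [set approx c n n C f s | n in [set n : nat | (1 <= n)%N]])
  = sem c C f.
Proof.
move=> Ff mf; have f0 : Exp f by exact: (suitable_F_exp HF).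
have esupf : esup (fun=> f) = f.
  apply/funext => s; apply/eqP; rewrite eq_le; apply/andP; split.
    exact: esup_leP.
  exact: (esup_ge (fun=> f s) 0%N).
have chf : chain (fun=> f) by split=> [//|s m n _]; exact: lexx.
apply/funext => s; apply/eqP; rewrite eq_le; apply/andP; split.
  by apply: ge_ereal_sup => _ [n /= n0 <-]; exact: approx_le_sem.
have -> : sem c C f = esup (fun n => dyadic_approx n C f).
  by rewrite -[in LHS]esupf approximable_all// esupf.
apply: esup_leP => n.
(* The term at [2 ^ n] has the resolution of the dyadic approximation and a greater depth, as
   [n < 2 ^ n]. *)
apply: le_ereal_sup_tmp; exists (approx c (2 ^ n) (2 ^ n) C f s).
  by exists (2 ^ n)%N => //=; rewrite expn_gt0.
rewrite /dyadic_approx -[X in _ <= approx _ X _ _ _ _]muln1.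
by apply: le_approx; rewrite ?expn_gt0// ltnW// ltn_expl.
Qed.

End Convergence.

(** * Complements *)

Section Complement.
Variable R : realType.
Local Open Scope ereal_scope.
Implicit Types x y : \bar R.

Lemma fin_num01 x : 0 <= x <= 1 -> x \is a fin_num.
Proof. by move=> /andP[x0 x1]; rewrite ge0_fin_numE// (le_lt_trans x1) ?ltry. Qed.

Lemma one_sub01 x : 0 <= x <= 1 -> 0 <= 1 - x <= 1.
Proof.
move=> x01; have := x01; rewrite -(fineK (fin_num01 x01)) -EFinB !lee_fin.
by rewrite subr_ge0 gerBl andbC.
Qed.

Lemma one_subK x : x \is a fin_num -> 1 - (1 - x) = x.
Proof. by move=> /fineK <-; rewrite -!EFinB opprB addrC subrK. Qed.

Lemma le_one_sub x y : x \is a fin_num -> y \is a fin_num ->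
  (1 - x <= 1 - y) = (y <= x).
Proof. by move=> /fineK <- /fineK <-; rewrite -!EFinB !lee_fin lerD2l lerN2. Qed.

Lemma ereal_sup01 (T : Type) (A : set T) (u : T -> \bar R) : A !=set0 ->
  (forall t, A t -> 0 <= u t <= 1) -> 0 <= ereal_sup [set u t | t in A] <= 1.
Proof.
move=> [t0 At0] u01; apply/andP; split; last first.
  by apply: ge_ereal_sup => _ [t At <-]; have /andP[] := u01 t At.
by apply: le_ereal_sup_tmp; exists (u t0); [exists t0|have /andP[] := u01 t0 At0].
Qed.

Lemma ereal_inf01 (T : Type) (A : set T) (u : T -> \bar R) : A !=set0 ->
  (forall t, A t -> 0 <= u t <= 1) -> 0 <= ereal_inf [set u t | t in A] <= 1.
Proof.
move=> [t0 At0] u01; apply/andP; split.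
  by apply: le_ereal_inf_tmp => _ [t At <-]; have /andP[] := u01 t At.
by apply: ge_ereal_inf; exists (u t0); [exists t0|have /andP[] := u01 t0 At0].
Qed.

Lemma ereal_inf_one_sub (T : Type) (A : set T) (u : T -> \bar R) : A !=set0 ->
  (forall t, A t -> 0 <= u t <= 1) ->
  ereal_inf [set 1 - u t | t in A] = 1 - ereal_sup [set u t | t in A].
Proof.
move=> A0 u01; have sfin := fin_num01 (ereal_sup01 A0 u01).
have v01 t : A t -> 0 <= 1 - u t <= 1 by move=> /u01; exact: one_sub01.
have i01 := ereal_inf01 A0 v01; have ifin := fin_num01 i01.
apply/eqP; rewrite eq_le; apply/andP; split; last first.
  apply: le_ereal_inf_tmp => _ [t At <-].
  rewrite le_one_sub ?(fin_num01 (u01 t At))//.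
  by apply: ereal_sup_ubound; exists t.
rewrite -[leLHS]one_subK// le_one_sub//; last exact: fin_num01 (one_sub01 i01).
apply: ge_ereal_sup => _ [t At <-].
rewrite -[leLHS]one_subK ?(fin_num01 (u01 t At))// le_one_sub ?(fin_num01 (v01 t At))//.
by apply: ereal_inf_lbound; exists t.
Qed.

Lemma convex_one_sub (p : R) x y : x \is a fin_num -> y \is a fin_num ->
  p%:E * (1 - x) + (1 - p)%R%:E * (1 - y) = 1 - (p%:E * x + (1 - p)%R%:E * y).
Proof.
move=> /fineK <- /fineK <-; rewrite -!EFinB -!EFinM -!EFinD -?EFinB.
by congr _%:E; ring.
Qed.

End Complement.

Section ComplementExpectation.
Variables (R : realType) (V : finType).
Local Open Scope ereal_scope.
Local Notation expT := (expectationT R V).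
Implicit Types (x : V) (f g : expT).

Definition compl f : expT := fun s => 1 - f s.

Lemma Exp1_compl f : Exp1 f -> Exp1 (compl f).
Proof. by move=> f01 s; exact: one_sub01. Qed.

Lemma complK f : Exp1 f -> compl (compl f) = f.
Proof. by move=> f01; apply/funext => s; rewrite /compl one_subK ?fin_num01. Qed.

Lemma Exp1_Exp f : Exp1 f -> Exp f.
Proof. by move=> f01 s; have /andP[] := f01 s. Qed.

Lemma Exp1_meas_compl f : Exp1_meas f -> Exp1_meas (compl f).
Proof.
move=> [f01 mf]; split; first exact: Exp1_compl.
by apply: emeasurable_funB => //; exact: measurable_cst.
Qed.

Lemma Exp1_meas_Exp_meas f : Exp1_meas f -> Exp_meas f.
Proof. by move=> [/Exp1_Exp]. Qed.

Lemma inf_on_compl (a b : R) x f : (a <= b)%R -> Exp1 f ->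
  inf_on a b x (compl f) = compl (sup_on a b x f).
Proof.
move=> ab f01; apply/funext => s; apply: ereal_inf_one_sub => [|xi _]; last exact: f01.
by exists a; rewrite /= in_itv /= lexx.
Qed.

Lemma Exp1_sup_on (a b : R) x f : (a <= b)%R -> Exp1 f -> Exp1 (sup_on a b x f).
Proof.
move=> ab f01 s; apply: ereal_sup01 => [|xi _]; last exact: f01.
by exists a; rewrite /= in_itv /= lexx.
Qed.

Lemma Exp1_inf_on (a b : R) x f : (a <= b)%R -> Exp1 f -> Exp1 (inf_on a b x f).
Proof.
move=> ab f01 s; apply: ereal_inf01 => [|xi _]; last exact: f01.
by exists a; rewrite /= in_itv /= lexx.
Qed.

Lemma sup_on_compl (a b : R) x f : (a <= b)%R -> Exp1 f ->
  sup_on a b x (compl f) = compl (inf_on a b x f).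
Proof.
move=> ab f01; rewrite -[in RHS](complK f01) inf_on_compl//; last exact: Exp1_compl.
by rewrite complK//; apply: Exp1_sup_on => //; exact: Exp1_compl.
Qed.

(** The weights [1 / N] sum to [1], so complementation passes through the average and exchanges
    suprema with infima. *)
Lemma unif_upper_compl N x f : (0 < N)%N -> Exp1 f ->
  unif_upper N x f = compl (unif_lower N x (compl f)).
Proof.
move=> N0 f01; apply/funext => s.
have N0' : (N%:R != 0 :> R)%R by rewrite pnatr_eq0 -lt0n.
have cell_le i : (i%:R / N%:R <= i.+1%:R / N%:R :> R)%R.
  by rewrite ler_pM2r ?invr_gt0 ?ltr0n// ler_nat.
rewrite /compl /unif_upper /unif_lower.
pose S i := sup_on (i%:R / N%:R)%R (i.+1%:R / N%:R)%R x f s.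
have SE i : S i = (fine (S i))%:E.
  by rewrite fineK// fin_num01//; exact: Exp1_sup_on.
rewrite (eq_bigr (fun i => (fine (S i))%:E)); last by move=> i _; exact: SE.
rewrite [in RHS](eq_bigr (fun i => (1 - fine (S i))%R%:E)); last first.
  by move=> i _; rewrite inf_on_compl// /compl -/(S i) SE.
rewrite !sumEFin -!EFinM -EFinB sumrB mulrBr; congr _%:E.
by rewrite sumr_const_nat subn0 mulVf// opprB addrC subrK.
Qed.

Lemma unif_int1 x : unif_int x (cst 1 : expT) = cst 1.
Proof.
apply/funext => s; rewrite /unif_int integral_cst//=.
by rewrite lebesgue_measure_itv/= lte_fin ltr01 -EFinB subr0 mul1e.
Qed.

(** The integrals of [f] and of its complement add up to the measure [1] of the unit interval. *)
Lemma unif_int_compl x f : Exp1_meas f ->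
  unif_int x f = compl (unif_int x (compl f)).
Proof.
move=> Hf; have [f01 mf] := Hf; have [g01 mg] := Exp1_meas_compl Hf.
apply/funext => s.
have sumE : unif_int x f s + unif_int x (compl f) s = 1.
  rewrite /unif_int -ge0_integralD//.
  - under eq_integral => xi _.
      rewrite /compl addeC subeK; last exact: fin_num01.
      over.
    by have := congr1 (fun h => h s) (unif_int1 x); exact.
  - by move=> xi _; have /andP[] := f01 (updr s x xi).
  - exact: measurable_funTS (measurable_slice s x (Exp1_meas_Exp_meas Hf)).
  - by move=> xi _; have /andP[] := g01 (updr s x xi).
  - exact: measurable_funTS (measurable_slice s x (Exp1_meas_Exp_meas (conj g01 mg))).
have i0 (h : expT) : Exp1 h -> 0 <= unif_int x h s.
  by move=> h01; apply: integral_ge0 => xi _; exact: Exp1_Exp.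
have ifin : unif_int x (compl f) s \is a fin_num.
  apply: fin_num01; rewrite i0//= -sumE leeDr//; exact: i0.
by rewrite -[RHS]/(1 - unif_int x (compl f) s) -sumE addeK.
Qed.

End ComplementExpectation.

(** * Suitability of the class of complements *)

Section DualClass.
Variables (R : realType) (V : finType).
Variables (E : set (aexp R V)) (G : set (guard R V)) (F : set (expectationT R V)).
Local Open Scope ereal_scope.

(** Values in [[0, 1]] make complementation an involution; it exchanges the constants [0] and [1]
    and the closure under infima and suprema. *)
Definition dual_class : set (expectationT R V) :=
  [set f | Exp1 f /\ F (compl f)].

(** The interval lengths telescope to [1], so each Riemann sum of [1 - u] is [1] minus that of
    [u]. *)
Lemma riemann_integrable_one_sub (u : R -> R) : riemann_integrable 0 1 u ->
  riemann_integrable 0 1 (fun xi => 1 - u xi)%R.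
Proof.
move=> [I HI]; exists (1 - I)%R => e e0; have [d d0 Hd] := HI e e0.
exists d => // xs t xsP y tP; have := Hd xs t xsP tP; rewrite -/y.
have [_ /eqP last1] := xsP.
have -> : (\sum_(0 <= i < size xs) (1 - u (t i)) * (y i.+1 - y i) =
    1 - \sum_(0 <= i < size xs) u (t i) * (y i.+1 - y i))%R.
  under eq_bigr => i _ do rewrite mulrBl mul1r.
  rewrite sumrB telescope_sumr//; congr (_ - _)%R.
  by rewrite /y /= -[X in nth _ _ X]/(size (0%R :: xs)).-1 nth_last /= last1 subr0.
by rewrite -normrN; congr (`|_| < _)%R; ring.
Qed.

Lemma riemann_suitable_dual : riemann_suitable E G F ->
  riemann_suitable E G dual_class.
Proof.
move=> HF; split.
- exact: suitable_E_bounded HF.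
- by move=> f [/Exp1_Exp].
- move=> f [f01 _] K _; apply: (@le_lt_trans _ _ 1); last exact: ltry.
  apply: ge_ereal_sup => _ [s _ <-]; have /andP[f0 f1] := f01 s.
  by rewrite gee0_abs.
- move=> f x [f01 Ff] s; have [ffin fR] := suitable_F_integrable HF x Ff s.
  split=> [xi _|]; first exact: fin_num01.
  have := riemann_integrable_one_sub fR; congr riemann_integrable.
  apply/funext => xi; rewrite /compl -[in LHS](fineK (fin_num01 (f01 (updr s x xi)))).
  by rewrite -EFinB /=; ring.
- split=> [s|]; first by rewrite lexx lee01.
  by have := suitable_1 HF; congr F; apply/funext => s; rewrite /compl sube0.
- split=> [s|]; first by rewrite lexx lee01.
  by have := suitable_0 HF; congr F; apply/funext => s; rewrite /compl subee.
- move=> f x a b [f01 Ff] a0 ab b1; split; first exact: Exp1_inf_on.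
  by rewrite -sup_on_compl//; exact: (suitable_sup HF).
- move=> f x a b [f01 Ff] a0 ab b1; split; first exact: Exp1_sup_on.
  by rewrite -inf_on_compl//; exact: (suitable_inf HF).
- move=> f e x [f01 Ff] Ee; split=> [s|]; first exact: f01.
  exact: (suitable_subst HF x Ff Ee).
- move=> f g p [f01 Ff] [g01 Fg]; have [p0 p1] := mix_prob R p.
  have mixE s : 1 - ((ratr p%:num)%:E * f s + (1 - ratr p%:num)%R%:E * g s) =
      (ratr p%:num)%:E * compl f s + (1 - ratr p%:num)%R%:E * compl g s.
    by rewrite convex_one_sub ?fin_num01.
  split=> [s|]; last by rewrite /compl (funext mixE); exact: (suitable_mix HF p Ff Fg).
  have /andP[f0 f1] := f01 s; have /andP[g0 g1] := g01 s.
  rewrite adde_ge0 ?mule_ge0//=.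
  have -> : 1 = (ratr p%:num)%:E * 1 + (1 - ratr p%:num)%R%:E * 1 :> \bar R.
    by rewrite !mule1 -EFinD addrC subrK.
  by apply: leeD; exact: lee_wpmul2l.
- move=> f g phi [f01 Ff] [g01 Fg] Gphi; split=> [s|].
    by rewrite iverson_if; case: ifP.
  have := suitable_if HF Ff Fg Gphi; congr F; apply/funext => s.
  by rewrite /compl !iverson_if; case: ifP.
Qed.

End DualClass.

(** * Identification of the four transformers with the generalized semantics *)

Section Correspondence.
Variables (R : realType) (V : finType).
Variables (E : set (aexp R V)) (G : set (guard R V)).
Local Open Scope ereal_scope.
Local Notation expT := (expectationT R V).
Implicit Types (C B : pWhile E G) (f g : expT).

(** In the loop case the supremum of the Kleene iterates is a least fixed point, and least fixed
    points are unique; hence [lfp] never takes its default value here. *)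
Lemma wpE C f : Exp_meas f -> wp C f = sem 0 C f.
Proof.
elim: C f => [||x e ?|phi ?|x|phi ? C1 ih1 C2 ih2|p C1 ih1 C2 ih2|
  C1 ih1 C2 ih2|phi Gphi B ih] f Hf //.
- by apply/funext => s; rewrite /wp /sem /=; case: ifP; rewrite /iverson /= ?mul1e ?mul0e.
- by apply/funext => s; have := ih1 f Hf; have := ih2 f Hf;
    rewrite /wp /sem /= iverson_if => -> ->.
- by apply/funext => s; have := ih1 f Hf; have := ih2 f Hf; rewrite /wp /sem /= => -> ->.
- have := ih2 f Hf; have := ih1 _ (Exp_meas_sem (lexx 0) C2 Hf).
  by rewrite /wp /sem /= => + ->.
- have HX := Exp_meas_sem (lexx 0) (While Gphi B) Hf.
  have bodyE Y : Exp_meas Y ->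
      (fun s => iverson R (~~ phi s) * f s + iverson R (phi s) * wp B Y s)
      = body 0 phi B f Y.
    by move=> HY; apply/funext => s; rewrite iverson_ifN /body ih.
  rewrite -[LHS]/(lfp (@Exp_meas R V) (fun Y s =>
    iverson R (~~ phi s) * f s + iverson R (phi s) * wp B Y s)).
  have least Z : Exp_meas Z ->
      (fun s => iverson R (~~ phi s) * f s + iverson R (phi s) * wp B Z s) = Z ->
      forall s, sem 0 (While Gphi B) f s <= Z s.
    by move=> HZ; rewrite bodyE// => ZE; apply: sem_While_least => // s; rewrite ZE.
  apply: xget_unique.
    by split=> //; rewrite bodyE// -sem_While_fixpoint.
  move=> Y [HY YE Yleast]; apply/funext => s; apply/eqP; rewrite eq_le least// andbT.
  by apply: Yleast => //; rewrite bodyE// -sem_While_fixpoint.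
Qed.

(** An unrolled program has no loops, so the fixed-point clause is never reached. *)
Lemma lower_wpE N l C f : lower_wp N (unroll C l) f = approx 0 N l C f.
Proof.
rewrite /lower_wp.
elim: C l f => [||x e ?|phi ?|x|phi ? C1 ih1 C2 ih2|p C1 ih1 C2 ih2|
  C1 ih1 C2 ih2|phi Gphi B ih] l f //.
- by apply/funext => s; rewrite /approx /=; case: ifP; rewrite /iverson /= ?mul1e ?mul0e.
- by apply/funext => s; rewrite /approx /= ih1 ih2 iverson_if.
- by apply/funext => s; rewrite /approx /= ih1 ih2.
- by rewrite /approx /= ih1 ih2.
- elim: l => [//|l ihl]; rewrite approx_WhileS; apply/funext => s /=.
  by rewrite iverson_if ih [transformer _ _ _ _ _]ihl.
Qed.

(** For loops the bound is Park induction with the constant [1] as pre-fixed point. *)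
Lemma Exp1_meas_sem C f : Exp1_meas f -> Exp1_meas (sem 1 C f).
Proof.
have one1 : Exp1_meas (cst 1 : expT).
  by split=> [s|]; [rewrite lexx lee01|exact: measurable_cst].
have le1 D h : Exp1_meas h -> (forall s, sem 1 D h s <= 1) -> Exp1_meas (sem 1 D h).
  move=> /Exp1_meas_Exp_meas Hh h1; have [h0 mh] := Exp_meas_sem lee01 D Hh.
  by split=> // s; rewrite h0 h1.
elim: C f => [||x e ?|phi ?|x|phi ? C1 ih1 C2 ih2|p C1 ih1 C2 ih2|
  C1 ih1 C2 ih2|phi Gphi B ih] f Hf;
  apply: le1 => // s.
- by have /andP[] := Hf.1 s.
- exact: lee01.
- by have /andP[] := Hf.1 (upd s x (e s)).
- by rewrite /sem /=; case: ifP => // _; have /andP[] := Hf.1 s.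
- rewrite -[leRHS]/(cst 1 s) -(unif_int1 R x).
  have [_ + _] := continuous_transformer_unif R x; apply.
  + exact: Exp1_meas_Exp_meas.
  + exact: Exp1_meas_Exp_meas.
  + by move=> t; have /andP[] := Hf.1 t.
- rewrite /sem /=; case: ifP => _.
    by have /andP[] := (ih1 f Hf).1 s.
  by have /andP[] := (ih2 f Hf).1 s.
- have [p0 p1] := mix_prob R p.
  rewrite [leRHS](_ : 1 = (ratr p%:num)%:E * 1 + (1 - ratr p%:num)%R%:E * 1); last first.
    by rewrite !mule1 -EFinD addrC subrK.
  apply: leeD; apply: lee_wpmul2l; rewrite ?lee_fin//.
    by have /andP[] := (ih1 f Hf).1 s.
  by have /andP[] := (ih2 f Hf).1 s.
- by have /andP[] := (ih1 _ (ih2 f Hf)).1 s.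
- apply: (@sem_While_least _ _ _ _ 1 lee01 phi Gphi B f (cst 1)) => //.
  + exact: Exp1_meas_Exp_meas.
  + exact: Exp1_meas_Exp_meas.
  + move=> t; rewrite /body; case: ifP => _.
      by have /andP[] := (ih _ one1).1 t.
    by have /andP[] := Hf.1 t.
Qed.

(** The upper bound comes from [sem 1 C] at the constant [1], which dominates the approximation. *)
Lemma Exp1_approx N l C f : (0 < N)%N -> Exp1 f -> Exp1 (approx 1 N l C f).
Proof.
move=> N0 f01 s; rewrite approx_ge0//=; last exact: Exp1_Exp.
have one1 : Exp1_meas (cst 1 : expT).
  by split=> [t|]; [rewrite lexx lee01|exact: measurable_cst].
have /andP[_ s1] := (Exp1_meas_sem C one1).1 s.
apply: le_trans s1; apply: approx_le_sem => //.
- exact: Exp1_Exp.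
- exact: Exp1_meas_Exp_meas.
- by move=> t; have /andP[] := f01 t.
Qed.

(** Complementation turns the value [1] of divergence into [0], the value [0] of a failed
    observation into [c = 1], and the greatest fixed point of a loop into the least. *)
Lemma wlpE C g : Exp1_meas g -> wlp C g = compl (sem 1 C (compl g)).
Proof.
elim: C g => [||x e ?|phi ?|x|phi ? C1 ih1 C2 ih2|p C1 ih1 C2 ih2|
  C1 ih1 C2 ih2|phi Gphi B ih] g Hg;
  have Hc := Exp1_meas_compl Hg.
- by rewrite [RHS]complK//; exact: Hg.1.
- by apply/funext => s; rewrite /compl /= sube0.
- by rewrite -[in LHS](complK Hg.1).
- apply/funext => s; rewrite /wlp /compl /= /sem /=; case: ifP => _; rewrite /iverson /=.
    by rewrite mul1e one_subK// fin_num01//; exact: Hg.1.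
  by rewrite mul0e subee.
- exact: unif_int_compl.
- apply/funext => s; have := ih1 g Hg; have := ih2 g Hg.
  by rewrite /wlp /sem /= iverson_if => -> ->; rewrite /compl; case: ifP.
- apply/funext => s; have := ih1 g Hg; have := ih2 g Hg.
  rewrite /wlp /sem /= => -> ->; rewrite /compl convex_one_sub//.
    by apply: fin_num01; exact: (Exp1_meas_sem C1 Hc).1.
  by apply: fin_num01; exact: (Exp1_meas_sem C2 Hc).1.
- have H2 := Exp1_meas_sem C2 Hc.
  have := ih1 _ (Exp1_meas_compl H2); have := ih2 g Hg.
  by rewrite complK; [rewrite /wlp /sem /= => -> ->|exact: H2.1].
- have HX := Exp1_meas_sem (While Gphi B) Hc.
  set X := sem 1 (While Gphi B) (compl g) in HX *.
  have HcE := Exp1_meas_Exp_meas Hc.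
  have bodyE Y : Exp1_meas Y ->
      (fun s => iverson R (~~ phi s) * g s + iverson R (phi s) * wlp B Y s)
      = compl (body 1 phi B (compl g) (compl Y)).
    move=> HY; apply/funext => s; rewrite iverson_ifN /compl /body ih//.
    by case: ifP => // _; rewrite one_subK// fin_num01//; exact: Hg.1.
  have fixX : body 1 phi B (compl g) X = X by rewrite -sem_While_fixpoint.
  rewrite -[LHS]/(gfp (@Exp1_meas R V) (fun Y s =>
    iverson R (~~ phi s) * g s + iverson R (phi s) * wlp B Y s)).
  have fixcX : (fun s => iverson R (~~ phi s) * g s +
      iverson R (phi s) * wlp B (compl X) s) = compl X.
    by rewrite bodyE ?complK ?fixX//; [exact: HX.1|exact: Exp1_meas_compl].
  have greatest Z : Exp1_meas Z ->
      (fun s => iverson R (~~ phi s) * g s + iverson R (phi s) * wlp B Z s) = Z ->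
      forall s, Z s <= compl X s.
    move=> HZ ZE s; have HcZ := Exp1_meas_compl HZ.
    rewrite -(complK HZ.1) le_one_sub ?fin_num01//; [|exact: HcZ.1|exact: HX.1].
    (* The complement of the fixed point [Z] is a fixed point of the complementary body, so the
       least one lies below it. *)
    apply: sem_While_least => // [|t]; first exact: Exp1_meas_Exp_meas.
    have b01 : Exp1 (body 1 phi B (compl g) (compl Z)).
      by move=> r; rewrite /body; case: ifP => _;
        [exact: (Exp1_meas_sem B HcZ).1|exact: Hc.1].
    by rewrite -[in leRHS]ZE bodyE// complK.
  apply: xget_unique; first by split=> //; exact: Exp1_meas_compl.
  move=> Y [HY YE Yg]; apply/funext => s; apply/eqP; rewrite eq_le greatest//=.
  by apply: Yg => //; exact: Exp1_meas_compl.
Qed.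

Lemma upper_wlpE N l C g : (0 < N)%N -> Exp1 g ->
  upper_wlp N (unroll C l) g = compl (approx 1 N l C (compl g)).
Proof.
move=> N0; rewrite /upper_wlp.
elim: C l g => [||x e ?|phi ?|x|phi ? C1 ih1 C2 ih2|p C1 ih1 C2 ih2|
  C1 ih1 C2 ih2|phi Gphi B ih] l g Hg;
  have Hc := Exp1_compl Hg.
- by rewrite [RHS]complK.
- by apply/funext => s; rewrite /compl /= sube0.
- by rewrite -[in LHS](complK Hg).
- apply/funext => s; rewrite /compl /approx /=; case: ifP => _; rewrite /iverson /=.
    by rewrite mul1e one_subK// fin_num01.
  by rewrite mul0e subee.
- exact: unif_upper_compl.
- by apply/funext => s; rewrite /= ih1// ih2// iverson_if /compl /approx /=; case: ifP.
- apply/funext => s; rewrite /= ih1// ih2// /compl convex_one_sub//.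
    by apply: fin_num01; exact: Exp1_approx.
  by apply: fin_num01; exact: Exp1_approx.
- have H2 := Exp1_approx l C2 N0 Hc.
  by rewrite /= ih2// ih1 ?complK//; exact: Exp1_compl.
- elim: l => [|l ihl]; first by apply/funext => s; rewrite /compl /= sube0.
  have HW := Exp1_approx l (While Gphi B) N0 Hc.
  rewrite approx_WhileS; apply/funext => s /=.
  have /= -> := ihl; rewrite iverson_if ih ?complK//; last exact: Exp1_compl.
  by rewrite /compl; case: ifP => // _; rewrite one_subK// fin_num01.
Qed.

End Correspondence.

(** * Convergence from below to wp and from above to wlp *)

Theorem theorem7p6 (R : realType) (V : finType)
    (E : set (aexp R V)) (G : set (guard R V)) (F : set (expectationT R V))
    (HEGF : riemann_suitable E G F)
    (C : pWhile E G) (f g : expectationT R V)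
    (Hf : (F `&` @Exp_meas R V) f) (Hg : (F `&` @Exp1_meas R V) g) :
  (fun s => ereal_sup
     [set lower_wp n (unroll C n) f s | n in [set n : nat | (1 <= n)%N]])
    = wp C f
  /\
  wlp C g
    = (fun s => ereal_inf
     [set upper_wlp n (unroll C n) g s | n in [set n : nat | (1 <= n)%N]]).
Proof.
have [[Ff Hmf] [Fg Hmg]] := (Hf, Hg); have Hc := Exp1_meas_compl Hmg; split.
  rewrite wpE// -(esup_approx HEGF (lexx 0%E) (suitable_0 HEGF) C Ff Hmf.2).
  apply/funext => s; congr ereal_sup; apply: eq_imagel => n _.
  by rewrite lower_wpE.
have Dg : dual_class F (compl g) by split; [exact: Hc.1|rewrite complK//; exact: Hmg.1].
have HD := riemann_suitable_dual HEGF.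
(* Convergence is used for the dual class with [c = 1]; the complement then turns the supremum into
   an infimum. *)
rewrite wlpE// -(esup_approx HD lee01 (suitable_1 HD) C Dg Hc.2).
apply/funext => s; rewrite /compl -ereal_inf_one_sub; last 2 first.
- by exists 1%N.
- by move=> n n0; apply: Exp1_approx => //; exact: Hc.1.
congr ereal_inf; apply: eq_imagel => n n0.
by rewrite upper_wlpE//; exact: Hmg.1.
Qed.
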